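(* Let $V_h\subset V=H_0^1(\Omega)$ and $Q_h\subset Q=H^{-1}(\Omega)$ be finite element subspaces satisfying the Babuška–Brezzi condition: there is $\beta>0$, independent of the mesh, with $$\sup_{0\ne v_h\in V_h}\frac{\langle v_h,\xi_h\rangle}{\|v_h\|_1}\ \ge\ \beta\,\|\xi_h\|_{-1}\qquad\forall\,\xi_h\in Q_h .$$ Let $(u,\lambda)\in V\times\Lambda$ be the solution of the mixed formulation of the obstacle problem, and let $(u_h,\lambda_h)\in V_h\times\Lambda_h$ be a solution of the mixed finite element method (both defined in the context). Then there is a constant $C>0$, independent of the mesh, such that $$\|u-u_h\|_1+\|\lambda-\lambda_h\|_{-1}\ \le\ C\Big(\inf_{v_h\in V_h}\|u-v_h\|_1+\inf_{\mu_h\in\Lambda_h}\big(\|\lambda-\mu_h\|_{-1}+\sqrt{\langle u-g,\mu_h\rangle}\,\big)\Big).$$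
   Context: $\Omega\subset\mathbb{R}^2$ is a convex polygon, $f\in L^2(\Omega)$, $g\in H^1(\Omega)\cap C(\overline\Omega)$ with $g=0$ on $\partial\Omega$. $\|v\|_1=(\|\nabla v\|_0^2+\|v\|_0^2)^{1/2}$, $(\cdot,\cdot)$ is the $L^2(\Omega)$ inner product, $\langle\cdot,\cdot\rangle:V\times Q\to\mathbb{R}$ the duality pairing, and $\|\xi\|_{-1}=\sup_{0\ne v\in V}\langle v,\xi\rangle/\|v\|_1$. Set $$\Lambda=\{\mu\in Q:\langle v,\mu\rangle\ge0\ \ \forall v\in V,\ v\ge0\text{ a.e. in }\Omega\},$$ $$\mathcal{B}(w,\xi;v,\mu)=(\nabla w,\nabla v)-\langle v,\xi\rangle-\langle w,\mu\rangle,\qquad \mathcal{L}(v,\mu)=(f,v)-\langle g,\mu\rangle .$$ Mixed formulation of the obstacle problem: $(u,\lambda)\in V\times\Lambda$ is the unique pair with $\mathcal{B}(u,\lambda;v,\mu-\lambda)\le\mathcal{L}(v,\mu-\lambda)$ for all $(v,\mu)\in V\times\Lambda$; equivalently $(\nabla u,\nabla v)-\langle v,\lambda\rangle=(f,v)$ for all $v\in V$ and $\langle u-g,\mu-\lambda\rangle\ge0$ for all $\mu\in\Lambda$. $\mathcal{C}_h$ is a conforming shape-regular triangulation of $\Omega$; $V_h$ and $Q_h\subset L^2(\Omega)$ consist of piecewise polynomials on $\mathcal{C}_h$, and $\Lambda_h=\{\mu_h\in Q_h:\mu_h\ge0\text{ in }\Omega\}\subset\Lambda$. Mixed finite element method: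 find $(u_h,\lambda_h)\in V_h\times\Lambda_h$ such that $$\mathcal{B}(u_h,\lambda_h;v_h,\mu_h-\lambda_h)\le\mathcal{L}(v_h,\mu_h-\lambda_h)\qquad\forall(v_h,\mu_h)\in V_h\times\Lambda_h .$$ The constant $C$ may depend only on $\Omega$ and $\beta$. *)

(* Defs.v *)
From HB Require Import structures.
From mathcomp Require Import all_boot all_order all_algebra.
From mathcomp Require Import all_classical all_reals all_analysis.
Import Order.TTheory GRing.Theory Num.Theory.
Import numFieldNormedType.Exports.

Set Implicit Arguments.
Unset Strict Implicit.
Unset Printing Implicit Defensive.

Local Open Scope classical_set_scope.
Local Open Scope ring_scope.

(* Elements of Lebesgue and Sobolev spaces are represented by functions, and
   compared only through almost everywhere equality or norms. *)
Notation planefun R := (R * R -> R)%type.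

Section Plane.
Context {R : realType}.
Implicit Types (O K : set (R * R)) (u v w g : R * R -> R) (e x y : R * R).

Definition mu2 :
    {measure set (measurableTypeR R * measurableTypeR R) -> \bar R} :=
  (lebesgue_measure \x lebesgue_measure)%E.

Definition e1 : R * R := (1, 0).
Definition e2 : R * R := (0, 1).

(* Euclidean distance (the library norm of R * R is the sup norm) *)
Definition edist x y : R := Num.sqrt ((x.1 - y.1) ^+ 2 + (x.2 - y.2) ^+ 2).

Definition chull (s : seq (R * R)) : set (R * R) :=
  [set x | exists a : 'I_(size s) -> R,
    [/\ forall i, 0 <= a i, \sum_i a i = 1
      & x = \sum_i a i *: tnth (in_tuple s) i]].

Definition convex_polygon O : Prop :=
  O !=set0 /\ exists s : seq (R * R), O = interior (chull s).

Definition bdry O : set (R * R) := closure O `\` interior O.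

Definition inner0 O u v : R := \int[mu2]_(x in O) (u x * v x).

Definition L2 O : set (planefun R) :=
  [set v | measurable_fun (O : set (measurableTypeR R * measurableTypeR R))
             (v : measurableTypeR R * measurableTypeR R -> R) /\
           mu2.-integrable O (fun x => (v x ^+ 2)%:E)].

Fixpoint Ck (k : nat) (phi : planefun R) : Prop :=
  continuous phi /\
  if k is k'.+1 then
    forall e, e = e1 \/ e = e2 ->
      (forall x, derivable phi x e) /\ Ck k' (fun x => 'D_e phi x)
  else True.

(* C_c^infinity(O), extended by zero to the plane *)
Definition test_fun O : set (planefun R) :=
  [set phi | (forall k, Ck k phi) /\
    exists K, [/\ compact K, K `<=` O & forall x, ~ K x -> phi x = 0]].

Definition is_weak_deriv O e v (p : planefun R) : Prop :=
  L2 O p /\ forall phi, test_fun O phi ->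
    inner0 O v (fun x => 'D_e phi x) = - inner0 O p phi.

Definition H1 O : set (planefun R) :=
  [set v | [/\ L2 O v, exists p, is_weak_deriv O e1 v p
             & exists p, is_weak_deriv O e2 v p]].

(* a choice of the weak derivative, which is unique up to a.e. equality in O *)
Definition wD O e v : planefun R := xget (cst 0) [set p | is_weak_deriv O e v p].

Definition gradip O u v : R :=
  inner0 O (wD O e1 u) (wD O e1 v) + inner0 O (wD O e2 u) (wD O e2 v).

Definition norm1 O v : R := Num.sqrt (gradip O v v + inner0 O v v).

(* V = H^1_0(O), the closure of the test functions in H^1(O) *)
Definition H10 O : set (planefun R) :=
  [set v | H1 O v /\
    forall eps : R, 0 < eps ->
      exists2 phi, test_fun O phi & norm1 O (v - phi) < eps].

Definition ae_ge0 O v : Prop := {ae mu2, forall x, O x -> 0 <= v x}.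
Definition ae_eq0 O v : Prop := {ae mu2, forall x, O x -> v x = 0}.

(* A functional is a map on all functions of which only the values on H10
   matter. *)
Definition pairing v (xi : planefun R -> R) : R := xi v.

Definition Hm1 O : set (planefun R -> R) :=
  [set xi |
    (forall (a : R) v w, H10 O v -> H10 O w ->
       pairing (a *: v + w) xi = a * pairing v xi + pairing w xi) /\
    exists M : R, forall v, H10 O v -> `|pairing v xi| <= M * norm1 O v].

(* the embedding of L^2(O) into H^{-1}(O), <v, m> = (v, m) *)
Definition L2dual O (m : planefun R) : planefun R -> R := fun v => inner0 O v m.

(* v ranges over the elements of W that are nonzero as a.e. classes; the
   library convention sup set0 = 0 applies when there is none. *)
Definition supquot O (W : set (planefun R)) (xi : planefun R -> R) : R :=
  sup [set r | exists v, [/\ W v, ~ ae_eq0 O v & r = pairing v xi / norm1 O v]].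

Definition normm1 O xi : R := supquot O (H10 O) xi.

Definition Lam O : set (planefun R -> R) :=
  [set m | Hm1 O m /\ forall v, H10 O v -> ae_ge0 O v -> 0 <= pairing v m].

Definition Bform O w xi v m : R := gradip O w v - pairing v xi - pairing w m.

Definition Lform O f g v m : R := inner0 O f v - pairing g m.

Definition obstacle_sol O f g u (lam : planefun R -> R) : Prop :=
  [/\ H10 O u, Lam O lam &
    forall v m, H10 O v -> Lam O m ->
      Bform O u lam v (m - lam) <= Lform O f g v (m - lam)].

(* A triangle is given by the list of its three vertices. *)
Definition triangle (T : seq (R * R)) : Prop :=
  exists a b c, T = [:: a; b; c] /\
    (b.1 - a.1) * (c.2 - a.2) - (b.2 - a.2) * (c.1 - a.1) != 0.

(* Two triangles meet in a common face: nothing, a vertex, an edge, or the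
   whole triangle. *)
Definition conforming_triangulation O (Th : seq (seq (R * R))) : Prop :=
  [/\ forall T, T \in Th -> triangle T,
      closure O = [set x | exists2 T, T \in Th & chull T x]
    & forall T T', T \in Th -> T' \in Th ->
        chull T `&` chull T' = chull [seq a <- T | a \in T']].

Definition diam K : R :=
  sup [set r | exists x y, [/\ K x, K y & r = edist x y]].

Definition indiam K : R :=
  sup [set d | exists c, [set x | edist c x <= d / 2] `<=` K].

Definition shape_regular (kappa : R) (Th : seq (seq (R * R))) : Prop :=
  forall T, T \in Th -> diam (chull T) <= kappa * indiam (chull T).

Definition polyfun (k : nat) : set (planefun R) :=
  [set p | exists a : nat -> nat -> R, forall x,
    p x = \sum_(i < k.+1) \sum_(j < k.+1 | (i + j <= k)%N)
            a i j * x.1 ^+ i * x.2 ^+ j].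

Definition fe_space (Th : seq (seq (R * R))) (W : set (planefun R)) : Prop :=
  [/\ W 0,
      forall (a : R) v w, W v -> W w -> W (a *: v + w)
    & exists k, forall v, W v -> forall T, T \in Th ->
        exists2 p, polyfun k p & {ae mu2, forall x, chull T x -> v x = p x}].

Definition babuska_brezzi O (beta : R) (Vh Qh : set (planefun R)) : Prop :=
  forall xi, Qh xi ->
    beta * normm1 O (L2dual O xi) <= supquot O Vh (L2dual O xi).

Definition Lamh O (Qh : set (planefun R)) : set (planefun R) :=
  [set m | Qh m /\ ae_ge0 O m].

Definition mixed_fem_sol O f g Vh Qh uh lamh : Prop :=
  [/\ Vh uh, Lamh O Qh lamh &
    forall vh mh, Vh vh -> Lamh O Qh mh ->
      Bform O uh (L2dual O lamh) vh (L2dual O (mh - lamh)) <=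
      Lform O f g vh (L2dual O (mh - lamh))].

End Plane.

(* Main.v *)
(* Testing the two problems against discrete functions gives the Galerkin
   orthogonality (grad (u - uh), grad vh) = <vh, lam - lamh>, which with the
   Babuska-Brezzi condition bounds the multiplier error by the energy error plus
   the distance from lam to Lambda_h.  Choosing 0 and twice the multiplier in the
   variational inequalities gives <u - g, lam> = <uh - g, lamh> = 0, hence
   <u - uh, lam - lamh> <= <u - uh, lam - mh> + <u - g, mh>; coercivity of the
   Dirichlet form then bounds the energy error.

   Coercivity rests on the identity (v, phi) = - (v, x1 d1 phi) - (d1 v, x1 phi)
   for test functions phi, which is the definition of the weak derivative tested
   with x1 phi; density turns it into ||v||_0 <= 2 max |x1| ||d1 v||_0 on
   H^1_0.  Linearity of the chosen weak derivative rests on its uniqueness, which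
   follows by approximating indicators of boxes by products of exp (- 1 / (n t)). *)
Require Import Defs.
From mathcomp Require Import all_boot all_order all_algebra.
From mathcomp Require Import all_classical all_reals all_analysis.
From mathcomp Require Import measurable_realfun ring lra.
Import Order.TTheory GRing.Theory Num.Theory.
Import numFieldNormedType.Exports.

Set Implicit Arguments.
Unset Strict Implicit.
Unset Printing Implicit Defensive.

Local Open Scope classical_set_scope.
Local Open Scope ring_scope.

(** * Semi-inner products and square-integrable functions *)

(** Functions are maps and not almost everywhere classes, and this shapes the proof. The inner
    products are only semi-definite, the weak derivative [wD] is a choice that is linear only up to
    null sets, and an element of H^{-1} is known to be linear only on [H10]. Identities between weak
    derivatives are therefore stated after pairing with an L2 function. The weight x1 works in the
    Poincaré inequality because d1 x1 = 1, so phi = d1 (x1 phi) - x1 d1 phi. The constant then sees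
    the domain through a bound M of |x1|, taken from the vertices of the polygon. The energy
    estimate is quadratic in the error E, while the pairing <u - g, mh> enters it linearly. This is
    why its square root appears in the final bound. Absorbing the quadratic terms, with b = 1/beta
    and K = 4 M^2 + 1, gives the constant (1 + b) (2 K (2 + b) + 1), fixed before the data and the
    mesh. *)

Section SemiInner.
Variables (R : rcfType) (V : lmodType R) (S : set V) (b : V -> V -> R).
Hypothesis S_lin : forall a v w, S v -> S w -> S (a *: v + w).
Hypothesis b_sym : forall v w, b v w = b w v.
Hypothesis b_lin : forall a u v w, S u -> S v -> S w ->
  b (a *: u + v) w = a * b u w + b v w.
Hypothesis b_ge0 : forall v, S v -> 0 <= b v v.

Lemma semi_inner_expand t u v : S u -> S v ->
  b (t *: u + v) (t *: u + v) = t ^+ 2 * b u u + 2 * t * b u v + b v v.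
Proof.
move=> Su Sv; have Sw := S_lin t Su Sv.
by rewrite b_lin// (b_sym u) (b_sym v) !b_lin// (b_sym v u); ring.
Qed.

(** The quadratic in t obtained from t u + v is nonnegative. As [b] is only semi-definite,
    [b u u = 0] does not force u = 0 and is a case of its own. *)
Lemma semi_inner_CS u v : S u -> S v ->
  `|b u v| <= Num.sqrt (b u u) * Num.sqrt (b v v).
Proof.
move=> Su Sv; have A0 := b_ge0 Su; have C0 := b_ge0 Sv.
have H t : 0 <= t ^+ 2 * b u u + 2 * t * b u v + b v v.
  by rewrite -semi_inner_expand//; apply/b_ge0/S_lin.
have BAC : b u v ^+ 2 <= b u u * b v v.
  have [AE|A1] := eqVneq (b u u) 0.
    have [->|B0] := eqVneq (b u v) 0; first by rewrite AE mul0r expr0n.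
    (* With a zero leading coefficient the quadratic is affine in t, and this t gives it the value
       -1. *)
    have := H (- (b v v + 1) / (2 * b u v)); rewrite AE mulr0 add0r.
    have -> : 2 * (- (b v v + 1) / (2 * b u v)) * b u v = - (b v v + 1).
      by field; rewrite B0.
    by move=> ?; lra.
  have A2 : 0 < b u u by rewrite lt_neqAle eq_sym A1.
  (* The minimiser of the quadratic. *)
  have := H (- b u v / b u u).
  have -> : (- b u v / b u u) ^+ 2 * b u u + 2 * (- b u v / b u u) * b u v
     + b v v = (b u u * b v v - b u v ^+ 2) / b u u by field.
  by rewrite pmulr_lge0 ?invr_gt0// subr_ge0.
by rewrite -sqrtrM// -sqrtr_sqr ler_wsqrtr.
Qed.

Lemma semi_inner_triangle u v : S u -> S v ->
  Num.sqrt (b (u + v) (u + v)) <= Num.sqrt (b u u) + Num.sqrt (b v v).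
Proof.
move=> Su Sv; have := semi_inner_expand 1 Su Sv; rewrite scale1r => ->.
rewrite -[leRHS]ger0_norm ?addr_ge0// -sqrtr_sqr ler_wsqrtr// sqrrD.
rewrite !sqr_sqrtr ?b_ge0//.
have := le_trans (ler_norm _) (semi_inner_CS Su Sv).
by move=> ?; lra.
Qed.

End SemiInner.

Section L2Space.
Context {R : realType}.
Implicit Types (O : set (R * R)) (u v w : R * R -> R).
Local Notation plane := (measurableTypeR R * measurableTypeR R)%type.
Local Notation mu := (@mu2 R).
Variables (O : set (R * R)) (mO : measurable (O : set plane)).

Lemma integrable_le u v : measurable_fun (O : set plane) (u : plane -> R) ->
  (forall x, O x -> `|u x| <= v x) ->
  mu.-integrable O (EFin \o v) -> mu.-integrable O (EFin \o u).
Proof.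
move=> mu_ uv iv; apply: le_integrable iv => //; first exact/measurable_EFinP.
move=> x Ox /=; rewrite lee_fin (le_trans (uv _ Ox))//; exact: ler_norm.
Qed.

Lemma L2_mul u v : L2 O u -> L2 O v ->
  mu.-integrable O (fun x => (u x * v x)%:E).
Proof.
move=> [mu_ iu] [mv iv].
apply: (@integrable_le (u \* v) (fun x => u x ^+ 2 + v x ^+ 2)).
- exact: measurable_funM.
- move=> x _ /=; rewrite normrM -[u x ^+ 2]real_normK ?num_real//.
  rewrite -[v x ^+ 2]real_normK ?num_real//.
  by have := sqr_ge0 (`|u x| - `|v x|); nra.
- exact: (integrableD _ iu iv).
Qed.

Lemma L2_lin a u v : L2 O u -> L2 O v -> L2 O (a *: u + v).
Proof.
move=> Lu Lv; have [mu_ iu] := Lu; have [mv iv] := Lv; split.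
  apply: (@measurable_funD _ _ _ _ (a \*: u)) => //.
  exact: (@measurable_funM _ _ _ _ (cst a)).
have i1 := integrableZl mO (a ^+ 2) iu.
have i2 := integrableZl mO (2 * a) (L2_mul Lu Lv).
have := integrableD mO (integrableD mO i1 i2) iv.
apply: eq_integrable => // x _; rewrite /= -!EFinM -!EFinD; congr EFin.
rewrite -[(a *: u + v) x]/(a * u x + v x); ring.
Qed.

Lemma inner0C u v : inner0 O u v = inner0 O v u.
Proof. by apply: eq_Rintegral => x _; rewrite mulrC. Qed.

Lemma inner0_lin a u v w : L2 O u -> L2 O v -> L2 O w ->
  inner0 O (a *: u + v) w = a * inner0 O u w + inner0 O v w.
Proof.
move=> Lu Lv Lw; rewrite /inner0 -RintegralZl//; last exact: (L2_mul Lu Lw).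
rewrite -RintegralD//; last exact: (L2_mul Lv Lw).
  by apply: eq_Rintegral => x _ /=; rewrite mulrDl mulrA.
exact: (integrableZl mO a (L2_mul Lu Lw)).
Qed.

Lemma inner0_ge0 u : 0 <= inner0 O u u.
Proof. by apply: Rintegral_ge0 => x _; rewrite -expr2 sqr_ge0. Qed.

End L2Space.

(** * Open sets and null sets of the plane *)

Section PlaneTopology.
Context {R : realType}.
Implicit Types (O K : set (R * R)).
Local Notation plane := (measurableTypeR R * measurableTypeR R)%type.
Local Notation mu := (@mu2 R).

Definition obox (a b c d : R) : set (R * R) := `]a, b[%classic `*` `]c, d[%classic.
Definition cbox (a b c d : R) : set (R * R) := `[a, b]%classic `*` `[c, d]%classic.

(** Candidates are the boxes with rational centre and half-width 1/(k+1), enumerated through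
    [pickle]; those not inside [O] are replaced by the empty box with bounds 1, 0. The closed boxes
    lie in [O] so that they can carry test functions. *)
Lemma open_boxes O : open O -> exists a b c d : nat -> R,
  (forall n, cbox (a n) (b n) (c n) (d n) `<=` O) /\
  O `<=` \bigcup_n obox (a n) (b n) (c n) (d n).
Proof.
move=> oO.
pose e (t : rat * rat * nat) : R := t.2.+1%:R^-1.
pose B t := cbox (ratr t.1.1 - e t) (ratr t.1.1 + e t)
                 (ratr t.1.2 - e t) (ratr t.1.2 + e t).
pose F n : R * R * R * R :=
  if unpickle n is Some t then
    if `[< B t `<=` O >] then
      (ratr t.1.1 - e t, ratr t.1.1 + e t, ratr t.1.2 - e t, ratr t.1.2 + e t)
    else (1, 0, 1, 0) else (1, 0, 1, 0).
exists (fun n => (F n).1.1.1), (fun n => (F n).1.1.2), (fun n => (F n).1.2),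
  (fun n => (F n).2); split.
  move=> n; have H0 : @cbox 1 0 1 0 `<=` O.
    by move=> [x y] [/=]; rewrite in_itv/= => /andP[x0 x1]; lra.
  rewrite /F; case: (unpickle n) => [t|//]; case: asboolP => // H.
move=> x Ox.
have /nbhs_ballP[r /= r0 Br] : nbhs x O by exact: open_nbhs_nbhs.
(* The centre will lie within d of x and the box reaches d further, so 2 d < r keeps it in the
   ball. *)
have r40 : 0 < r / 2 by rewrite divr_gt0.
have [k _ kr] := near_infty_natSinv_lt (PosNum r40).
have {}kr : k.+1%:R^-1 < r / 2 by exact: (kr k (leqnn k)).
set d : R := k.+1%:R^-1 in kr.
have d0 : 0 < d by rewrite invr_gt0.
have h1 : x.1 - d < x.1 + d by lra.
have h2 : x.2 - d < x.2 + d by lra.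
have [q1] := rat_in_itvoo h1; rewrite in_itv/= => /andP[q1a q1b].
have [q2] := rat_in_itvoo h2; rewrite in_itv/= => /andP[q2a q2b].
exists (pickle (q1, q2, k)) => //.
have -> : F (pickle (q1, q2, k)) =
  (ratr q1 - d, ratr q1 + d, ratr q2 - d, ratr q2 + d).
  rewrite /F pickleK; case: asboolP => //= -[]; move=> y []; rewrite /e/= -/d.
  rewrite !in_itv/= => /andP[y1a y1b] /andP[y2a y2b].
  by apply: Br; split; rewrite /ball/= ltr_norml; apply/andP; split; lra.
by split; rewrite /= in_itv/=; apply/andP; split; lra.
Qed.

Lemma measurable_obox a b c d : measurable (obox a b c d : set plane).
Proof. by apply: measurableX; exact: measurable_itv. Qed.

Lemma open_measurable_plane O : open O -> measurable (O : set plane).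
Proof.
move=> /open_boxes[a [b [c [d [sO Os]]]]].
suff -> : O = \bigcup_n obox (a n) (b n) (c n) (d n).
  by apply: bigcupT_measurable => n; exact: measurable_obox.
apply/seteqP; split => // x [n _ [h1 h2]]; apply: (sO n).
by split; apply: subset_itv_oo_cc.
Qed.

Lemma continuous_measurable_plane (f : R * R -> R) :
  continuous f -> measurable_fun setT (f : plane -> R).
Proof.
move=> /continuousP cf; apply: (measurability _ (RGenOpens.measurableE R)).
move=> _ [_ [a [b ->] <-]]; rewrite setTI; apply: open_measurable_plane.
exact/cf/interval_open.
Qed.

Lemma negligible_boxes (P : R * R -> Prop) O : open O ->
  (forall a b c d, cbox a b c d `<=` O ->
    {ae mu, forall x, obox a b c d x -> P x}) ->
  {ae mu, forall x, O x -> P x}.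
Proof.
move=> /open_boxes[a [b [c [d [sO Os]]]]] H.
have : mu.-negligible (\bigcup_n
    ~` [set x | obox (a n) (b n) (c n) (d n) x -> P x]).
  by apply: negligible_bigcup => n; exact: H.
apply: negligibleS => x /= /not_implyP[Ox nP].
by have [n _ xn] := Os _ Ox; exists n => //= /(_ xn).
Qed.

End PlaneTopology.

(** * Functions whose integrals vanish on a generating family *)

Section IntegralEq0.
Local Open Scope ereal_scope.
Context d1 d2 (T1 : measurableType d1) (T2 : measurableType d2) (R : realType).
Variables (m : {measure set T1 -> \bar R}) (D : set T1) (q : T1 -> R).
Hypotheses (mD : measurable D) (iq : m.-integrable D (EFin \o q)).
Variables (f : T1 -> T2) (G : set (set T2)).
Hypotheses (mf : measurable_fun setT f) (GI : setI_closed G).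
Hypothesis GE : @measurable d2 T2 = <<s G >>.

(** Dynkin's argument: the sets [A] whose preimage in [D] carries a zero integral form a
    lambda-system, and [G] is closed under intersection. The map [f] allows one coordinate to be
    treated at a time. *)
Lemma integral_eq0_generated : \int[m]_(x in D) (q x)%:E = 0 ->
  (forall A, G A -> \int[m]_(x in D `&` f @^-1` A) (q x)%:E = 0) ->
  forall A, measurable A -> \int[m]_(x in D `&` f @^-1` A) (q x)%:E = 0.
Proof.
move=> D0 G0.
pose H : set (set T2) := [set A | measurable A /\
  \int[m]_(x in D `&` f @^-1` A) (q x)%:E = 0].
have mDf A : measurable A -> measurable (D `&` f @^-1` A).
  by move=> mA; apply: measurableI => //; rewrite -[X in measurable X]setTI; exact: mf.
have iDf A : measurable A -> m.-integrable (D `&` f @^-1` A) (EFin \o q).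
  by move=> mA; apply: integrableS iq => //; exact: mDf.
have HD : setSD_closed H.
  move=> A B BA [mA A0] [mB B0]; have mAB : measurable (A `\` B) by exact: measurableD.
  split=> //.
  have E : D `&` f @^-1` A = (D `&` f @^-1` B) `|` (D `&` f @^-1` (A `\` B)).
    by rewrite -setIUr -preimage_setU setDUK.
  move: A0; rewrite E integral_setU; [|exact: mDf|exact: mDf| |].
  - by rewrite B0 add0e.
  - by rewrite -E; exact: (measurable_int _ (iDf _ mA)).
  - by apply/disj_setPS => x /= [[_ Bx] [_ [_]]].
suff lH : lambda_system setT H.
  move=> A; rewrite GE => GA.
  have GH : G `<=` H.
    by move=> B GB; split; [rewrite GE; exact: sub_sigma_algebra|exact: G0].
  by have [] := lambda_system_subset GI lH GH (fun _ _ _ _ => I) GA.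
split => //.
- by split => //; rewrite preimage_setT setIT.
- move=> F ndF HF; have mF n : measurable (F n) by have [] := HF n.
  split; first exact: bigcupT_measurable.
  (* The increasing union is split into disjoint differences, over which the integral is countably
     additive. *)
  rewrite -eq_bigcup_seqD preimage_bigcup setI_bigcupr.
  have HS n : H (seqD F n).
    case: n => [|n] /=; first exact: HF.
    by apply: HD => //; apply/subsetPset/ndF.
  have mS n : measurable (seqD F n) by have [] := HS n.
  rewrite integral_bigcup.
  + by rewrite eseries0// => n _ _; have [] := HS n.
  + apply/trivIsetP => i j _ _ ij.
    have /trivIsetP/(_ i j I I ij) E := trivIset_seqD ndF.
    by rewrite setIACA setIid -preimage_setI E preimage_set0 setI0.
  + by move=> n; apply: mDf.
  + rewrite -setI_bigcupr -preimage_bigcup; apply: iDf.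
    exact: bigcupT_measurable.
Qed.

End IntegralEq0.

Section BoxIntegralEq0.
Context {R : realType}.
Local Notation plane := (measurableTypeR R * measurableTypeR R)%type.
Local Notation mu := (@mu2 R).

Lemma setI_closed_rays : setI_closed (@RGenOInfty.G R).
Proof.
move=> _ _ [a ->] [b ->]; exists (Num.max a b).
apply/seteqP; split=> x /=; rewrite !in_itv/= !andbT gt_max.
  by move=> [-> ->].
by move=> /andP[].
Qed.

Lemma setI_closed_rectangles : setI_closed
  [set A `*` B | A in @measurable _ (measurableTypeR R) &
                 B in @measurable _ (measurableTypeR R)].
Proof.
move=> _ _ [A mA [B mB <-]] [A' mA' [B' mB' <-]].
exists (A `&` A'); first exact: measurableI.
by exists (B `&` B'); [exact: measurableI|rewrite setXI].
Qed.

(** Moving the lower left corner amounts to intersecting the box with a ray in each coordinate. Rays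
    generate the Borel sets of the line, which frees the first coordinate and then the second;
    rectangles generate the product sigma-algebra, and a function with zero integral on every
    measurable subset vanishes almost everywhere. *)
Lemma ae_eq0_subboxes (a b c d : R) (p : R * R -> R) :
  mu.-integrable (obox a b c d) (EFin \o p) ->
  (forall a' c', a <= a' -> c <= c' ->
    (\int[mu]_(x in obox a' b c' d) (p x)%:E = 0)%E) ->
  {ae mu, forall x, obox a b c d x -> p x = 0}.
Proof.
set D := obox a b c d => ip H.
have mD : measurable (D : set plane) := measurable_obox a b c d.
have HR a' c' : (\int[mu]_(x in D `&` fst @^-1` `]a', +oo[ `&`
    snd @^-1` `]c', +oo[) (p x)%:E = 0)%E.
  rewrite [X in integral _ X _](_ : _ = obox (Num.max a a') b (Num.max c c') d).
    by apply: H; rewrite le_max lexx.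
  apply/seteqP; split=> -[x y] /=; rewrite /D/obox/= !in_itv/= !andbT !gt_max.
    by move=> [[[/andP[-> ->] /andP[-> ->]] ->] ->].
  by move=> [/andP[/andP[-> ->] ->] /andP[/andP[-> ->] ->]].
have m1 : measurable_fun setT (fst : plane -> measurableTypeR R).
  exact: measurable_fst.
have m2 : measurable_fun setT (snd : plane -> measurableTypeR R).
  exact: measurable_snd.
have mr (r : R) : measurable (`]r, +oo[%classic : set (measurableTypeR R)).
  exact: measurable_itv.
have HY c' A : measurable (A : set (measurableTypeR R)) ->
    (\int[mu]_(x in D `&` snd @^-1` `]c', +oo[ `&` fst @^-1` A) (p x)%:E = 0)%E.
  have mDc : measurable ((D `&` snd @^-1` `]c', +oo[%classic) : set plane).
    by apply: measurableI => //; rewrite -[X in measurable X]setTI; exact: m2.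
  apply: (integral_eq0_generated mDc _ m1 setI_closed_rays (RGenOInfty.measurableE R)).
  - by apply: integrableS ip.
  - have := HR a c'; congr (integral _ _ _ = _).
    by rewrite setIAC; apply: setIidl => -[x y] [[/= + _] _];
      rewrite !in_itv/= andbT => /andP[].
  - by move=> _ [a' ->]; rewrite setIAC.
have HX A B : measurable (A : set (measurableTypeR R)) ->
    measurable (B : set (measurableTypeR R)) ->
    (\int[mu]_(x in D `&` fst @^-1` A `&` snd @^-1` B) (p x)%:E = 0)%E.
  move=> mA.
  have mDc : measurable ((D `&` fst @^-1` A) : set plane).
    by apply: measurableI => //; rewrite -[X in measurable X]setTI; exact: m1.
  apply: (integral_eq0_generated mDc _ m2 setI_closed_rays (RGenOInfty.measurableE R)).
  - by apply: integrableS ip.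
  - have := HY c _ mA; congr (integral _ _ _ = _).
    by rewrite setIAC; apply: setIidl => -[x y] [[/= _ +] _];
      rewrite !in_itv/= andbT => /andP[].
  - by move=> _ [c' ->]; rewrite setIAC; exact: HY.
have HZ A : measurable (A : set plane) ->
    (\int[mu]_(x in D `&` id @^-1` A) (p x)%:E = 0)%E.
  apply: (integral_eq0_generated mD ip _ setI_closed_rectangles) => //.
  - exact: measurable_prod_measurableType.
  - by have := HX _ _ measurableT measurableT; rewrite !preimage_setT !setIT.
  - move=> _ [A1 mA1 [A2 mA2 <-]]; have := HX _ _ mA1 mA2.
    congr (integral _ _ _ = _); apply/seteqP; split=> x /=.
      by move=> [[]].
    by move=> [? []].
have : ae_eq mu D (EFin \o p) (cst 0%E).
  apply: integral_ae_eq => // E ED mE; rewrite integral0.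
  by have := HZ E mE; rewrite preimage_id setIC setIidl.
by apply: filterS => x /= + Dx => /(_ Dx) [].
Qed.

End BoxIntegralEq0.

(** * Smooth functions with flat zeros *)

Section CkTheory.
Context {R : realType}.
Implicit Types (f g : R * R -> R).

Lemma Ck_cont k f : Ck k f -> continuous f.
Proof. by case: k => [|k] []. Qed.

(** Trades the unknown ['D_e f] for an explicit candidate [df e], so that smoothness of concrete
    functions goes by induction on [k]. *)
Lemma CkS k f (df : R * R -> R * R -> R) : continuous f ->
  (forall e, e = e1 \/ e = e2 ->
    (forall x, is_derive x e f (df e x)) /\ Ck k (df e)) ->
  Ck k.+1 f.
Proof.
move=> cf H; split => // e /H[D C]; split=> [x|]; first exact: ex_derive.
by rewrite (_ : (fun x => _) = df e)//; apply/funext => x; rewrite derive_val.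
Qed.

Lemma Ck_is_derive k f e x : Ck k.+1 f -> e = e1 \/ e = e2 ->
  is_derive x e f ('D_e f x).
Proof. by move=> [_ H] /H[D _]; exact/derivableP. Qed.

Lemma Ck_derive k f e : Ck k.+1 f -> e = e1 \/ e = e2 ->
  Ck k (fun x => 'D_e f x).
Proof. by move=> [_ H] /H[]. Qed.

Lemma Ck_pred k f : Ck k.+1 f -> Ck k f.
Proof.
elim: k f => [|k IH] f [cf H]; first by split.
by split => // e /H[D C]; split => //; exact: IH.
Qed.

Lemma Ck_cst k (c : R) : Ck k (cst c : R * R -> R).
Proof.
elim: k c => [|k IH] c; first by split => //; exact: cst_continuous.
apply: (@CkS _ _ (fun _ => cst 0)); first exact: cst_continuous.
by move=> e _; split => [x|]; [exact: is_derive_cst|exact: IH].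
Qed.

Lemma CkD k f g : Ck k f -> Ck k g -> Ck k (f + g).
Proof.
elim: k f g => [|k IH] f g Cf Cg.
  by split => // x; exact: (@continuousD _ _ _ f g x (@Ck_cont _ _ Cf x) (@Ck_cont _ _ Cg x)).
apply: (@CkS _ _ (fun e => (fun x => 'D_e f x) + (fun x => 'D_e g x))).
  by move=> x; exact: (@continuousD _ _ _ f g x (@Ck_cont _ _ Cf x) (@Ck_cont _ _ Cg x)).
move=> e he; split=> [x|].
  by apply: is_deriveD; [exact: (Ck_is_derive _ Cf he)|exact: (Ck_is_derive _ Cg he)].
by apply: IH; exact: Ck_derive.
Qed.

Lemma CkM k f g : Ck k f -> Ck k g -> Ck k (f * g).
Proof.
elim: k f g => [|k IH] f g Cf Cg.
  by split => // x; exact: (@continuousM _ _ f g x (@Ck_cont _ _ Cf x) (@Ck_cont _ _ Cg x)).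
apply: (@CkS _ _ (fun e => f * (fun x => 'D_e g x) + g * (fun x => 'D_e f x))).
  by move=> x; exact: (@continuousM _ _ f g x (@Ck_cont _ _ Cf x) (@Ck_cont _ _ Cg x)).
move=> e he; split=> [x|].
  by apply: is_deriveM; [exact: (Ck_is_derive _ Cf he)|exact: (Ck_is_derive _ Cg he)].
by apply: CkD; apply: IH; [exact: Ck_pred|exact: Ck_derive|exact: Ck_pred|exact: Ck_derive].
Qed.

Lemma CkZ k (a : R) f : Ck k f -> Ck k (a *: f).
Proof. by move=> Cf; exact: (CkM (Ck_cst k a) Cf). Qed.

Lemma derive_quotient_line (g : R * R -> R) x v :
  (fun h : R => h^-1 *: ((g \o shift x) (h *: v) - g x)) =
  (fun h : R => h^-1 *: (((fun t : R => g (t *: v + x)) \o shift 0) (h *: 1)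
      - (fun t : R => g (t *: v + x)) 0)).
Proof.
apply/funext => h /=; rewrite scale0r add0r addr0.
by rewrite [h *: (1 : R)]mulr1.
Qed.

(** Both sides have the same difference quotient. This brings the one-variable rules to directional
    derivatives in the plane. *)
Lemma is_derive_line (g : R * R -> R) x v l :
  is_derive (0 : R) 1 (fun t : R => g (t *: v + x)) l <-> is_derive x v g l.
Proof.
split=> -[D <-].
  by split; rewrite /derivable /derive derive_quotient_line.
by split; rewrite /derivable /derive -derive_quotient_line.
Qed.

Lemma continuous_fst : continuous (fst : R * R -> R).
Proof. by move=> x; exact: cvg_fst. Qed.

Lemma continuous_snd : continuous (snd : R * R -> R).
Proof. by move=> x; exact: cvg_snd. Qed.

Lemma is_derive_linear (c d t : R) : is_derive t (1:R) (fun s : R => c * s + d) c.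
Proof.
have := is_deriveD (is_deriveZ c (is_derive_id t (1:R))) (is_derive_cst d t (1:R)).
by rewrite addr0 [c *: _]mulr1.
Qed.

Lemma is_derive_fst (x v : R * R) : is_derive x v (fst : R * R -> R) v.1.
Proof.
apply/is_derive_line; have := is_derive_linear v.1 x.1 0.
by congr (is_derive _ _ _ _); apply/funext => t /=; rewrite mulrC.
Qed.

Lemma Ck_fst k : Ck k (fst : R * R -> R).
Proof.
case: k => [|k]; first by split => //; exact: continuous_fst.
apply: (@CkS _ _ (fun e => cst e.1)); first exact: continuous_fst.
by move=> e _; split=> [x|]; [exact: is_derive_fst|exact: Ck_cst].
Qed.

Definition affine (l : R * R * R) (x : R * R) := l.1.1 * x.1 + l.1.2 * x.2 + l.2.

Lemma continuous_affine l : continuous (affine l).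
Proof.
move=> x; apply: cvgD; last exact: cvg_cst.
by apply: cvgD; apply: cvgM; [exact: cvg_cst|exact: continuous_fst|
  exact: cvg_cst|exact: continuous_snd].
Qed.

Lemma is_derive_comp_affine l (h : R -> R) (dh : R) x v :
  is_derive (affine l x) (1:R) h dh ->
  is_derive x v (h \o affine l) ((l.1.1 * v.1 + l.1.2 * v.2) * dh).
Proof.
move=> Dh; apply/is_derive_line; set c := l.1.1 * v.1 + _.
have -> : (fun t : R => (h \o affine l) (t *: v + x)) =
    h \o (fun t => c * t + affine l x).
  apply/funext => t /=; congr h; rewrite /affine /c/=.
  by rewrite /GRing.scale/=; ring.
rewrite mulrC; apply: is_derive1_comp; first by rewrite mulr0 add0r.
exact: is_derive_linear.
Qed.

End CkTheory.

(** * The functions P(1/t) exp(-1/t) *)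

Section FlatFunction.
Context {R : realType}.
Implicit Types (P : {poly R}) (t y : R).

(** [P = 1] gives the classical smooth function exp(-1/t) with a flat zero; the polynomial factor
    makes the family closed under differentiation. *)
Definition flat P t : R := if 0 < t then P.[t^-1] * expR (- t^-1) else 0.

(* (P (1/t) exp (-1/t))' = Q (1/t) exp (-1/t) with Q = X^2 (P - P'). *)
Definition flat_deriv P : {poly R} := 'X^2 * (P - P^`()).

(** The induction on [P] keeps [m] free: the factor X of [P * 'X + c] is passed on to the power of
    y. *)
Lemma poly_le_expR P m : exists2 C : R, 0 <= C &
  forall y, 0 < y -> `|P.[y]| * y ^+ m <= C * expR y.
Proof.
elim/poly_ind: P m => [|P c IH] m.
  by exists 0 => // y y0; rewrite horner0 normr0 !mul0r.
have [C C0 HC] := IH m.+1.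
exists (C + `|c| * m.+1`!%:R) => [|y y0].
  by rewrite addr_ge0// mulr_ge0.
have ym : y ^+ m <= m.+1`!%:R * expR y.
  case: m {HC IH} => [|m].
    by rewrite expr0 mul1r ltW// expR_gt1.
  have := @expR_ge1Dxn R y m (ltW y0) => H.
  have : y ^+ m.+1 / m.+1`!%:R <= expR y by lra.
  rewrite ler_pdivrMr ?ltr0n ?fact_gt0// mulrC => /le_trans; apply.
  by rewrite ler_wpM2r ?expR_ge0// ler_nat leq_pfact.
rewrite !hornerE; apply: (@le_trans _ _ ((`|P.[y]| * y + `|c|) * y ^+ m)).
  rewrite ler_wpM2r ?exprn_ge0// ?(ltW y0)// (le_trans (ler_normD _ _))//.
  by rewrite normrM (gtr0_norm y0).
rewrite !mulrDl lerD//.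
  by have := HC y y0; rewrite exprS mulrA.
by rewrite -mulrA ler_wpM2l.
Qed.

(** The exponential beats P(1/t) with two powers of 1/t to spare: one absorbs the division in the
    difference quotient at 0, the other sends it to 0. *)
Lemma flat_quadratic P : exists2 C : R, 0 <= C &
  forall t, `|flat P t| <= C * t ^+ 2.
Proof.
have [C C0 HC] := poly_le_expR P 2; exists C => // t; rewrite /flat.
case: ifPn => [t0|_]; last by rewrite normr0 mulr_ge0// sqr_ge0.
have := HC t^-1; rewrite invr_gt0 => /(_ t0).
rewrite normrM (ger0_norm (expR_ge0 _)) expRN.
rewrite ler_pdivrMr ?expR_gt0// exprVn ler_pdivrMr ?exprn_gt0// => H.
by rewrite mulrAC.
Qed.

Lemma is_derive_flat P t : is_derive t (1:R) (flat P) (flat (flat_deriv P) t).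
Proof.
have [t0|t0|->] := ltgtP t 0.
- have -> : flat (flat_deriv P) t = 0 by rewrite /flat ltNge (ltW t0).
  apply: (@near_eq_is_derive _ _ _ (cst 0)).
  near=> s; rewrite /flat ltNge ifF//; apply/negbTE; rewrite negbK.
  by apply: ltW; near: s; exact: lt_nbhsl.
- rewrite /flat t0.
  apply: (@near_eq_is_derive _ _ _ (fun s : R => P.[s^-1] * expR (- s^-1))).
    near=> s; rewrite ifT//; near: s; exact: lt_nbhsr.
  have tn0 : t != 0 by rewrite gt_eqF.
  have DV := is_deriveV tn0 (is_derive_id t (1:R)).
  have DP := is_derive1_comp (is_derive_poly P t^-1) DV.
  have DE := @is_derive1_comp R expR (fun s => - s^-1) t _ _
    (is_derive_expR (- t^-1)) (is_deriveN DV).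
  apply: is_derive_eq (is_deriveM DP DE) _.
  rewrite /flat_deriv !hornerE /GRing.scale/=; field => //.
- have -> : flat (flat_deriv P) 0 = 0 by rewrite /flat ltxx.
  have [C C0 HC] := flat_quadratic P.
  suff H : h^-1 *: ((flat P \o shift 0) (h *: (1:R)) - flat P 0) @[h --> 0^'] --> (0:R).
    by split; [apply/cvg_ex; exists 0|apply/cvg_lim].
  have F0 : flat P 0 = 0 by rewrite /flat ltxx.
  rewrite F0; apply/cvgr0Pnorm_lt => eps eps0; near=> h.
  have h0 : h != 0 by near: h; exact: nbhs_dnbhs_neq.
  rewrite /= addr0 subr0 [h *: _]mulr1 /GRing.scale/= normrM normfV.
  rewrite ltr_pdivrMl ?normr_gt0//.
  apply: (le_lt_trans (HC h)); rewrite -real_normK ?num_real// expr2 mulrA mulrC.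
  rewrite ltr_pM2l ?normr_gt0//.
  (* C may be 0, hence C + 1. *)
  have : `|h| < eps / (C + 1).
    near: h; apply: dnbhs0_lt; rewrite divr_gt0// ltr_wpDl//.
  rewrite ltr_pdivlMr ?ltr_wpDl// => H; apply: le_lt_trans H.
  by rewrite mulrC ler_wpM2l// lerDl.
Unshelve. all: by end_near. Qed.

Lemma continuous_flat P : continuous (flat P).
Proof.
move=> t; apply: differentiable_continuous; apply/derivable1_diffP.
by case: (is_derive_flat P t).
Qed.

(** The induction closes because a partial derivative is a constant multiple of another [flat]
    function of the same affine form. *)
Lemma Ck_flat k P l : Ck k (flat P \o affine l).
Proof.
have cf Q : continuous (flat Q \o affine l).
  by move=> x; apply: continuous_comp; [exact: continuous_affine|exact: continuous_flat].
elim: k P => [|k IH] P; first by split.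
apply: (@CkS _ _ _ (fun e => (l.1.1 * e.1 + l.1.2 * e.2) *:
   (flat (flat_deriv P) \o affine l))) => // e _; split=> [x|]; last exact/CkZ/IH.
exact/is_derive_comp_affine/is_derive_flat.
Qed.

Lemma flat1_ge0_le1 t : 0 <= flat 1 t <= 1.
Proof.
rewrite /flat; case: ifPn => [t0|_]; last by rewrite lexx ler01.
by rewrite hornerC mul1r expR_ge0/= expR_le1 oppr_le0 invr_ge0 ltW.
Qed.

Lemma flat1_cvg t : 0 < t -> flat 1 (n.+1%:R * t) @[n --> \oo] --> (1 : R).
Proof.
move=> t0.
have -> : (fun n => flat 1 (n.+1%:R * t)) = (fun n => expR (- (n.+1%:R^-1 * t^-1))).
  by apply/funext => n; rewrite /flat mulr_gt0// hornerC mul1r invfM.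
rewrite -[X in _ --> X](expR0); apply: continuous_cvg; first exact: continuous_expR.
rewrite -oppr0; apply: cvgN; rewrite -(mul0r t^-1); apply: cvgMr_tmp.
exact: cvg_harmonic.
Qed.

End FlatFunction.

(** * The fundamental lemma of the calculus of variations *)

Section FundamentalLemma.
Context {R : realType}.
Implicit Types (O K : set (R * R)).
Local Notation plane := (measurableTypeR R * measurableTypeR R)%type.
Local Notation mu := (@mu2 R).

(** One factor for each side of the box, with t the signed distance to that side. The support stays
    in the same closed box for all [n], and the constant 1 dominates the whole sequence. *)
Definition bump (a b c d : R) (n : nat) : R * R -> R :=
  (flat 1 \o affine (n.+1%:R, 0, - (n.+1%:R * a))) *
  (flat 1 \o affine (- n.+1%:R, 0, n.+1%:R * b)) *
  ((flat 1 \o affine (0, n.+1%:R, - (n.+1%:R * c))) *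
  (flat 1 \o affine (0, - n.+1%:R, n.+1%:R * d))).

Lemma bumpE a b c d n x : bump a b c d n x =
  flat 1 (n.+1%:R * (x.1 - a)) * flat 1 (n.+1%:R * (b - x.1)) *
  (flat 1 (n.+1%:R * (x.2 - c)) * flat 1 (n.+1%:R * (d - x.2))).
Proof.
by rewrite /bump; congr (_ * _ * (_ * _)); rewrite /= /affine/=; congr flat; ring.
Qed.

Lemma bump_out a b c d n x : ~ obox a b c d x -> bump a b c d n x = 0.
Proof.
move=> H; rewrite bumpE /flat.
rewrite !pmulr_rgt0// !subr_gt0.
have [h1|] := boolP (a < x.1); last by rewrite !mul0r.
have [h2|] := boolP (x.1 < b); last by rewrite mulr0 mul0r.
have [h3|] := boolP (c < x.2); last by rewrite mul0r mulr0.
have [h4|] := boolP (x.2 < d); last by rewrite !mulr0.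
by exfalso; apply: H; split; rewrite /= in_itv/=; apply/andP.
Qed.

Lemma bump_ge0_le1 a b c d n x : 0 <= bump a b c d n x <= 1.
Proof.
have H (y y' : R) : 0 <= y <= 1 -> 0 <= y' <= 1 -> 0 <= y * y' <= 1.
  by move=> /andP[y0 y1] /andP[z0 z1]; rewrite mulr_ge0//= mulr_ile1.
by rewrite bumpE; apply: (H _ _ (H _ _ _ _) (H _ _ _ _)); exact: flat1_ge0_le1.
Qed.

Lemma bump_cvg a b c d x : obox a b c d x ->
  bump a b c d n x @[n --> \oo] --> (1 : R).
Proof.
move=> [/=]; rewrite !in_itv/= => /andP[ax xb] /andP[cx xd].
under eq_fun do rewrite bumpE.
have P (s t : R) : s < t -> 0 < t - s by rewrite subr_gt0.
have := cvgM (cvgM (flat1_cvg (P _ _ ax)) (flat1_cvg (P _ _ xb)))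
  (cvgM (flat1_cvg (P _ _ cx)) (flat1_cvg (P _ _ xd))).
by rewrite !mulr1; apply.
Qed.

Lemma bump_test O a b c d n : cbox a b c d `<=` O -> test_fun O (bump a b c d n).
Proof.
move=> BO; split=> [k|].
  by do !apply: CkM; exact: Ck_flat.
exists (cbox a b c d); split => // [|x xB].
  by apply: compact_setX; exact: segment_compact.
apply: bump_out => -[x1 x2]; apply: xB.
by split; apply: subset_itv_oo_cc.
Qed.

Lemma mu_obox_lty a b c d : (mu (obox a b c d) < +oo)%E.
Proof.
have -> : mu (obox a b c d) = (@lebesgue_measure R `]a, b[ * @lebesgue_measure R `]c, d[)%E.
  by apply: product_measure1E; exact: measurable_itv.
by rewrite !lebesgue_measure_itv/=; do 2 case: ifP => _; rewrite ?mul0e ?mule0 ?ltry.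
Qed.

Lemma L2_integrable (D : set (R * R)) p : measurable (D : set plane) ->
  (mu D < +oo)%E -> L2 D p -> mu.-integrable D (EFin \o p).
Proof.
move=> mD Dfin [mp ip].
apply: (@integrable_le _ D mD p (fun x => p x ^+ 2 + 1)) => //.
  move=> x _; rewrite -[p x ^+ 2]real_normK ?num_real//.
  by have := sqr_ge0 (`|p x| - 1); have := normr_ge0 (p x); nra.
have i1 : mu.-integrable D (EFin \o cst 1).
  apply: measurable_bounded_integrable => //.
  by exists 1; split; [exact: num_real|move=> C C1 x _ /=; rewrite normr1 ltW].
exact: (integrableD mD ip i1).
Qed.

Lemma L2S (D E : set (R * R)) p : measurable (D : set plane) ->
  measurable (E : set plane) -> E `<=` D -> L2 D p -> L2 E p.
Proof.
move=> mD mE ED [mp ip]; split; first exact: measurable_funS mp.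
exact: integrableS ip.
Qed.

Lemma compact_sub_obox K : compact K ->
  exists2 M : R, 0 < M & K `<=` obox (- M) M (- M) M.
Proof.
move=> /compact_bounded /ex_strict_bound_gt0 [M M0 HM]; exists M => // x Kx.
have : `|x| < M by exact: HM.
rewrite prod_normE gt_max => /andP[x1 x2].
by split; rewrite /= in_itv/= -ltr_norml.
Qed.

Lemma compact_support_integrable (phi : R * R -> R) K : compact K ->
  continuous phi -> (forall x, ~ K x -> phi x = 0) ->
  mu.-integrable setT (EFin \o phi).
Proof.
move=> cK cphi phi0; have [M M0 KM] := compact_sub_obox cK.
have mD := measurable_obox (- M) M (- M) M; set D := obox _ _ _ _ in mD KM.
have : mu.-integrable D (EFin \o phi).
  apply: measurable_bounded_integrable => //; first exact: mu_obox_lty.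
    by apply: measurable_funTS; exact: continuous_measurable_plane.
  have /compact_bounded : compact (phi @` K).
    by apply: continuous_compact => //; exact: continuous_subspaceT.
  move=> [B [Br HB]]; exists (Num.max B 0); split; first exact: num_real.
  move=> C; rewrite gt_max => /andP[BC C0] x Dx /=.
  have [Kx|nKx] := pselect (K x); first by apply: HB => //; exists x.
  by rewrite phi0// normr0 ltW.
move/(integrable_mkcond _ mD); apply: eq_integrable => // x _ /=.
rewrite /patch; case: ifPn => //; rewrite notin_setE => nD.
by rewrite phi0// => /KM.
Qed.

Lemma test_L2 O phi : measurable (O : set plane) -> test_fun O phi -> L2 O phi.
Proof.
move=> mO [Cphi [K [cK KO phi0]]].
have cphi : continuous phi by exact: (@Ck_cont _ 0).
split; first by apply: measurable_funTS; exact: continuous_measurable_plane.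
apply: (@integrableS _ _ _ _ setT) => //.
apply: (@compact_support_integrable (fun x => phi x ^+ 2) K) => //.
  have := @Ck_cont _ 0 _ (CkM (Cphi 0) (Cphi 0)).
  by rewrite (_ : phi * phi = fun x => phi x ^+ 2).
by move=> x /phi0 ->; rewrite expr0n.
Qed.

(** On a closed box inside [O] the bumps are admissible, and dominated convergence with majorant |p|
    turns the tested identities into a zero integral over the open box. Smaller boxes with the same
    upper right corner qualify as well, and countably many boxes cover [O]. *)
Lemma ae_eq0_test O p : open O -> L2 O p ->
  (forall phi, test_fun O phi -> inner0 O p phi = 0) -> Defs.ae_eq0 O p.
Proof.
move=> oO Lp H; have mO := open_measurable_plane oO.
apply: negligible_boxes => // a b c d BO.
have sub a' b' c' d' : cbox a' b' c' d' `<=` O ->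
    mu.-integrable (obox a' b' c' d') (EFin \o p).
  move=> BO'; apply: L2_integrable; [exact: measurable_obox|exact: mu_obox_lty|].
  apply: (L2S mO _ _ Lp); first exact: measurable_obox.
  move=> x [x1 x2]; apply: BO'; split; exact: subset_itv_oo_cc.
apply: ae_eq0_subboxes => [|a' c' aa' cc']; first exact: sub.
have BO' : cbox a' b c' d `<=` O.
  move=> x [/= x1 x2]; apply: BO; move: x1 x2; rewrite /cbox/= !in_itv/=.
  by move=> /andP[x1 ->] /andP[x2 ->]; rewrite (le_trans aa')// (le_trans cc').
set D := obox a' b c' d; have ip : mu.-integrable D (EFin \o p) by exact: sub.
have mD : measurable (D : set plane) by exact: measurable_obox.
pose f n x : \bar R := (p x * bump a' b c' d n x)%:E.
have mb n : measurable_fun D (bump a' b c' d n : plane -> R).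
  apply: measurable_funTS; apply: continuous_measurable_plane.
  by apply: (@Ck_cont _ 0); case: (bump_test n BO').
have mp : measurable_fun D (p : plane -> R).
  by apply/measurable_EFinP; exact: (measurable_int mu ip).
have f0 n : (\int[mu]_(x in D) f n x = 0)%E.
  have Tn := bump_test n BO'.
  have if_ : mu.-integrable O (f n) by exact: (L2_mul mO Lp (test_L2 mO Tn)).
  (* [inner0] is a real number obtained through [fine], so integrability is needed to return to the
     extended integral. *)
  have := congr1 EFin (H _ Tn); rewrite /inner0 /Rintegral fineK; last first.
    exact: (integrable_fin_num mO if_).
  (* The bump vanishes outside the box, so the integrals over [O] and over [D] have the same
     extension by zero. *)
  move=> E; apply: etrans E; rewrite [LHS]integral_mkcond [RHS]integral_mkcond.
  apply: eq_integral => x _; rewrite /patch.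
  case: ifPn => xD.
    rewrite ifT// inE; apply: BO'; move: xD; rewrite inE => -[x1 x2].
    by split; apply: subset_itv_oo_cc.
  case: ifP => // _; rewrite /f bump_out ?mulr0//.
  by move: xD; rewrite notin_setE.
have [| | | | |_ _] := @dominated_convergence _ _ _ mu D mD f
  (fun x => (p x)%:E) (fun x => `|(p x)%:E|%E).
  - move=> n; apply/measurable_EFinP; exact: (measurable_funM mp (mb n)).
  - exact: (measurable_int mu ip).
  - apply: aeW => x Dx; apply: cvg_EFin; first exact: nearW.
    have := @cvgMl_tmp _ _ _ _ _ (p x) _ (bump_cvg Dx).
    by rewrite mulr1; apply.
  - exact: integrable_abse.
  - apply: aeW => x n Dx; rewrite /f /= lee_fin normrM.
    have /andP[b0 b1] := bump_ge0_le1 a' b c' d n x.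
    by rewrite (ger0_norm b0) ler_piMr.
have -> : [sequence (\int[mu]_(x in D) f n x)%E]_n = cst 0%E by apply/funext.
by move/cvg_lim => <- //; rewrite lim_cst.
Qed.

End FundamentalLemma.

(** * Integration by parts for test functions *)

Section IntegrationByParts.
Context {R : realType}.
Implicit Types (O K : set (R * R)) (phi psi chi : R * R -> R).
Local Notation plane := (measurableTypeR R * measurableTypeR R)%type.
Local Notation mu := (@mu2 R).
Local Notation leb := (@lebesgue_measure R).

(** The fundamental theorem of calculus on [-M, M], where [F] is 0 at both ends. *)
Lemma integral_derivative_eq0 (F f : R -> R) (M : R) : 0 < M ->
  (forall x : R, is_derive x 1 F (f x)) -> continuous f ->
  (forall x, M <= `|x| -> F x = 0) -> (forall x, M <= `|x| -> f x = 0) ->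
  (\int[leb]_x (f x)%:E = 0)%E.
Proof.
move=> M0 DF cf F0 f0.
have -> : (\int[leb]_x (f x)%:E = \int[leb]_(x in `[(- M)%R, M]) (f x)%:E)%E.
  rewrite [RHS]integral_mkcond; apply: eq_integral => x _; rewrite /patch.
  case: ifPn => //; rewrite notin_setE /= in_itv/= -ler_norml => /negP.
  by rewrite -ltNge => /ltW/f0 ->.
have cF : continuous F.
  move=> x; apply: differentiable_continuous; apply/derivable1_diffP.
  by case: (DF x).
rewrite (@continuous_FTC2 _ f F); last first.
- by move=> x _; rewrite derive1E; have [_ ->] := DF x.
- split; first by move=> x _; case: (DF x).
  + exact: cvg_at_right_filter (cF _).
  + exact: cvg_at_left_filter (cF _).
- exact: continuous_subspaceT.
- by rewrite -subr_gt0 opprK addr_gt0.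
by rewrite !F0 ?subee// ?normrN ger0_norm// ltW.
Qed.

Lemma is_derive_slice1 chi (x y l : R) : is_derive (x, y) e1 chi l ->
  is_derive x 1 (fun t => chi (t, y)) l.
Proof.
move=> /is_derive_line D.
have -> : (fun t => chi (t, y)) =
    (fun t : R => chi (t *: e1 + (x, y))) \o (fun t => 1 * t + (- x)).
  apply/funext => t /=; congr chi; rewrite /e1 /GRing.scale/=.
  by congr (_, _); rewrite /= /GRing.scale/=; ring.
rewrite -[l]mulr1; apply: is_derive1_comp; last exact: is_derive_linear.
by rewrite mul1r subrr.
Qed.

Lemma is_derive_slice2 chi (x y l : R) : is_derive (x, y) e2 chi l ->
  is_derive y 1 (fun t => chi (x, t)) l.
Proof.
move=> /is_derive_line D.
have -> : (fun t => chi (x, t)) =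
    (fun t : R => chi (t *: e2 + (x, y))) \o (fun t => 1 * t + (- y)).
  apply/funext => t /=; congr chi; rewrite /e2 /GRing.scale/=.
  by congr (_, _); rewrite /= /GRing.scale/=; ring.
rewrite -[l]mulr1; apply: is_derive1_comp; last exact: is_derive_linear.
by rewrite mul1r subrr.
Qed.

(** [K] is closed, so [chi] is zero on a whole neighbourhood of a point outside it. *)
Lemma derive_out K chi e x : compact K -> (forall x, ~ K x -> chi x = 0) ->
  ~ K x -> 'D_e chi x = 0.
Proof.
move=> cK chi0 Kx.
rewrite (@near_eq_derive _ _ _ chi (cst 0)) ?derive_cst//.
have oK : open (~` K).
  by apply: closed_openC; apply: compact_closed => //; exact: norm_hausdorff.
by have := open_nbhs_nbhs (conj oK Kx); apply: filterS => z /chi0.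
Qed.

(** Fubini with the inner integral taken along [e], where the one-dimensional result applies. *)
Lemma integral_derive_eq0 K chi e : compact K -> Ck 1 chi ->
  (forall x, ~ K x -> chi x = 0) -> e = e1 \/ e = e2 ->
  (\int[mu]_x ('D_e chi x)%:E = 0)%E.
Proof.
move=> cK Cchi chi0 he.
have D0 x := @derive_out K chi e x cK chi0.
have cD : continuous (fun x => 'D_e chi x) := @Ck_cont _ 0 _ (Ck_derive Cchi he).
have iD := compact_support_integrable cK cD D0.
have [M M0 KM] := compact_sub_obox cK.
have out1 x y : M <= `|x| -> ~ K (x, y).
  by move=> Mx /KM [/=]; rewrite in_itv/= -ltr_norml ltNge Mx.
have out2 x y : M <= `|y| -> ~ K (x, y).
  by move=> Mx /KM [_ /=]; rewrite in_itv/= -ltr_norml ltNge Mx.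
case: (he) => ee; rewrite ee in iD cD D0 *.
- rewrite -(integral21_prod_meas1 iD) integral0_eq// => y _.
  apply: (@integral_derivative_eq0 (fun x => chi (x, y)) _ M) => //.
  + by move=> x; apply: is_derive_slice1; apply: (Ck_is_derive _ Cchi); left.
  + move=> x; apply: (@continuous_comp _ _ _ (fun x => (x, y)) (fun z => 'D_e1 chi z)).
      by apply: (@cvg_pair _ _ _ _ (nbhs x) (nbhs y)); [exact: cvg_id|exact: cvg_cst].
    exact: cD.
  + by move=> x Mx; apply: chi0; exact: out1.
  + by move=> x Mx; apply: D0; exact: out1.
- rewrite -(integral12_prod_meas1 iD) integral0_eq// => x _.
  apply: (@integral_derivative_eq0 (fun y => chi (x, y)) _ M) => //.
  + by move=> y; apply: is_derive_slice2; apply: (Ck_is_derive _ Cchi); right.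
  + move=> y; apply: (@continuous_comp _ _ _ (fun y => (x, y)) (fun z => 'D_e2 chi z)).
      by apply: (@cvg_pair _ _ _ _ (nbhs x) (nbhs y)); [exact: cvg_cst|exact: cvg_id].
    exact: cD.
  + by move=> y My; apply: chi0; exact: out2.
  + by move=> y My; apply: D0; exact: out2.
Qed.

Lemma test_fun_derive O phi e : test_fun O phi -> e = e1 \/ e = e2 ->
  test_fun O (fun x => 'D_e phi x).
Proof.
move=> [Cphi [K [cK KO phi0]]] he; split; first by move=> k; exact: Ck_derive.
by exists K; split => // x; exact: derive_out.
Qed.

Lemma test_fun_mul O g phi : (forall k, Ck k g) -> test_fun O phi ->
  test_fun O (g * phi).
Proof.
move=> Cg [Cphi [K [cK KO phi0]]]; split; first by move=> k; exact: CkM.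
exists K; split => // x /phi0 E.
by rewrite -[(g * phi) x]/(g x * phi x) E mulr0.
Qed.

Lemma test_fun_lin O (a : R) phi psi : test_fun O phi -> test_fun O psi ->
  test_fun O (a *: phi + psi).
Proof.
move=> [Cphi [K [cK KO phi0]]] [Cpsi [L [cL LO psi0]]]; split.
  by move=> k; apply: CkD => //; exact: CkZ.
exists (K `|` L); split; [exact: compactU|by move=> x [/KO|/LO]|].
move=> x /not_orP[/phi0 Ex /psi0 Ey].
by rewrite -[(_ + _) x]/(a * phi x + psi x) Ex Ey mulr0 addr0.
Qed.

(** The derivative of [phi * psi] integrates to 0 over the plane, and the product rule splits that
    integral. The support of [phi] lies in [O], so integrating over [O] or over the plane is the
    same. *)
Lemma test_weak_deriv O phi e : measurable (O : set plane) ->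
  test_fun O phi -> e = e1 \/ e = e2 ->
  is_weak_deriv O e phi (fun x => 'D_e phi x).
Proof.
move=> mO Tphi he; have TD := test_fun_derive Tphi he.
split=> [|psi Tpsi]; first exact: test_L2.
have TDpsi := test_fun_derive Tpsi he.
have [Cphi [K [cK KO phi0]]] := Tphi; have [Cpsi _] := Tpsi.
apply/eqP; rewrite -addr_eq0; apply/eqP.
have C1 : Ck 1 (phi * psi) := CkM (Cphi 1) (Cpsi 1).
have phipsi0 x : ~ K x -> (phi * psi) x = 0.
  by move=> /phi0 E; rewrite -[_ x]/(phi x * psi x) E mul0r.
rewrite /inner0 -RintegralD//; first last.
- exact: (L2_mul mO (test_L2 mO TD) (test_L2 mO Tpsi)).
- exact: (L2_mul mO (test_L2 mO Tphi) (test_L2 mO TDpsi)).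
rewrite /Rintegral -[RHS]/(fine 0%E) -(integral_derive_eq0 cK C1 phipsi0 he).
congr fine; rewrite [LHS]integral_mkcond; apply: eq_integral => x _.
have DM := is_deriveM (Ck_is_derive x (Cphi 1) he) (Ck_is_derive x (Cpsi 1) he).
have [_ ->] := DM; rewrite /patch /GRing.scale/= (mulrC (psi x)).
case: ifPn => //; rewrite notin_setE => nO.
rewrite phi0 ?mul0r ?add0r; last by move=> /KO.
by rewrite (derive_out _ cK phi0) ?mul0r//; move=> /KO.
Qed.

Lemma test_H1 O phi : measurable (O : set plane) -> test_fun O phi -> H1 O phi.
Proof.
move=> mO Tphi; split; first exact: test_L2.
- by eexists; apply: test_weak_deriv => //; left.
- by eexists; apply: test_weak_deriv => //; right.
Qed.

End IntegrationByParts.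

(** * Sobolev spaces and the Poincare inequality *)

Section Sobolev.
Context {R : realType}.
Implicit Types (O : set (R * R)) (u v w p q phi psi : R * R -> R).
Local Notation plane := (measurableTypeR R * measurableTypeR R)%type.
Local Notation mu := (@mu2 R).
Variables (O : set (R * R)) (oO : open O).
Let mO : measurable (O : set plane).
Proof. exact: open_measurable_plane. Qed.

Lemma inner0_ae_eq0 p w : L2 O p -> L2 O w -> Defs.ae_eq0 O p -> inner0 O p w = 0.
Proof.
move=> Lp Lw p0; have [mp _] := Lp; have [mw _] := Lw.
rewrite /inner0 /Rintegral (ae_eq_integral (cst 0%E)) ?integral0//.
  by apply/measurable_EFinP; exact: measurable_funM.
apply: negligibleS p0 => x /=; apply: contra_not => H Ox; by rewrite H// mul0r.
Qed.

Lemma test_fun_0 : test_fun O 0.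
Proof.
split; first by move=> k; exact: (Ck_cst k 0).
by exists set0; split => //; exact: compact0.
Qed.

Lemma L2_0 : L2 O 0. Proof. exact: test_L2 test_fun_0. Qed.

Lemma inner0_0l w : inner0 O 0 w = 0.
Proof.
rewrite /inner0 /Rintegral integral0_eq// => x _.
by rewrite -[(0 : R * R -> R) x]/(0 : R) mul0r.
Qed.

Lemma L2Z a u : L2 O u -> L2 O (a *: u).
Proof. by move=> Lu; rewrite -[a *: u]addr0; apply: L2_lin => //; exact: L2_0. Qed.

Lemma L2B u v : L2 O u -> L2 O v -> L2 O (u - v).
Proof. by move=> Lu Lv; rewrite addrC -scaleN1r; exact: L2_lin. Qed.

Lemma inner0Z a u w : L2 O u -> L2 O w -> inner0 O (a *: u) w = a * inner0 O u w.
Proof.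
move=> Lu Lw; rewrite -[a *: u]addr0 inner0_lin//; last exact: L2_0.
by rewrite inner0_0l addr0.
Qed.

Lemma inner0D u v w : L2 O u -> L2 O v -> L2 O w ->
  inner0 O (u + v) w = inner0 O u w + inner0 O v w.
Proof. by move=> *; rewrite -[u]scale1r inner0_lin// mul1r scale1r. Qed.

Lemma inner0B u v w : L2 O u -> L2 O v -> L2 O w ->
  inner0 O (u - v) w = inner0 O u w - inner0 O v w.
Proof. by move=> *; rewrite addrC -scaleN1r inner0_lin// mulN1r addrC. Qed.

Definition norm0 v := Num.sqrt (inner0 O v v).

Lemma inner0_CS u v : L2 O u -> L2 O v -> `|inner0 O u v| <= norm0 u * norm0 v.
Proof.
move=> Lu Lv; apply: (@semi_inner_CS _ _ (L2 O) (inner0 O)) => //.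
- by move=> *; exact: L2_lin.
- by move=> *; exact: inner0C.
- by move=> *; exact: inner0_lin.
- by move=> *; exact: inner0_ge0.
Qed.

Lemma norm0_triangle u v : L2 O u -> L2 O v ->
  norm0 (u + v) <= norm0 u + norm0 v.
Proof.
move=> Lu Lv; apply: (@semi_inner_triangle _ _ (L2 O) (inner0 O)) => //.
- by move=> *; exact: L2_lin.
- by move=> *; exact: inner0C.
- by move=> *; exact: inner0_lin.
- by move=> *; exact: inner0_ge0.
Qed.

(** The difference [p - q] is orthogonal to all test functions, hence null. The equality is tested
    against [w] because [p] and [q] agree only almost everywhere. *)
Lemma weak_deriv_unique e v p q w : is_weak_deriv O e v p ->
  is_weak_deriv O e v q -> L2 O w -> inner0 O p w = inner0 O q w.
Proof.
move=> [Lp Hp] [Lq Hq] Lw; apply/eqP; rewrite -subr_eq0 -inner0B//; apply/eqP.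
apply: inner0_ae_eq0 => //; first exact: L2B.
apply: ae_eq0_test => //; first exact: L2B.
move=> phi Tphi; rewrite inner0B//; last exact: test_L2.
have := Hp _ Tphi; rewrite (Hq _ Tphi) => /oppr_inj ->; exact: subrr.
Qed.

Lemma weak_deriv_lin e a u v p q : e = e1 \/ e = e2 -> L2 O u -> L2 O v ->
  is_weak_deriv O e u p -> is_weak_deriv O e v q ->
  is_weak_deriv O e (a *: u + v) (a *: p + q).
Proof.
move=> he Lu Lv [Lp Hp] [Lq Hq]; split; first exact: L2_lin.
move=> phi Tphi; have L := test_L2 mO Tphi.
have LD := test_L2 mO (test_fun_derive Tphi he).
by rewrite !inner0_lin// Hp// Hq// mulrN opprD.
Qed.

Lemma wDP e v : e = e1 \/ e = e2 -> H1 O v -> is_weak_deriv O e v (wD O e v).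
Proof.
by move=> he [_ [p1 H1] [p2 H2]]; rewrite /wD; apply: xgetPex;
  case: he => ->; [exists p1|exists p2].
Qed.

Lemma wD_L2 e v : e = e1 \/ e = e2 -> H1 O v -> L2 O (wD O e v).
Proof. by move=> he Hv; case: (wDP he Hv). Qed.

Lemma H1_L2 v : H1 O v -> L2 O v. Proof. by case. Qed.

Lemma H1_lin a u v : H1 O u -> H1 O v -> H1 O (a *: u + v).
Proof.
move=> Hu Hv; have Lu := H1_L2 Hu; have Lv := H1_L2 Hv.
split; first exact: L2_lin.
- by eexists; apply: weak_deriv_lin => //; [left|apply: wDP..] => //; left.
- by eexists; apply: weak_deriv_lin => //; [right|apply: wDP..] => //; right.
Qed.

(** The chosen derivative of the combination and the combination of the chosen derivatives may
    differ on a null set; pairing with [w] hides this. *)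
Lemma wD_lin e a u v w : e = e1 \/ e = e2 -> H1 O u -> H1 O v -> L2 O w ->
  inner0 O (wD O e (a *: u + v)) w =
  a * inner0 O (wD O e u) w + inner0 O (wD O e v) w.
Proof.
move=> he Hu Hv Lw; rewrite -inner0_lin//; [|exact: wD_L2..].
apply: (@weak_deriv_unique e (a *: u + v)) => //; first exact/wDP/H1_lin.
by apply: weak_deriv_lin => //; [exact: H1_L2|exact: H1_L2|exact: wDP..].
Qed.

Lemma gradipC u v : gradip O u v = gradip O v u.
Proof. by rewrite /gradip [X in X + _ = _]inner0C [X in _ + X = _]inner0C. Qed.

Lemma gradip_lin a u v w : H1 O u -> H1 O v -> H1 O w ->
  gradip O (a *: u + v) w = a * gradip O u w + gradip O v w.
Proof.
move=> Hu Hv Hw; have he1 : @e1 R = e1 \/ @e1 R = e2 by left.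
have he2 : @e2 R = e1 \/ @e2 R = e2 by right.
rewrite /gradip [X in X + _ = _](wD_lin a he1 Hu Hv (wD_L2 he1 Hw)).
rewrite [X in _ + X = _](wD_lin a he2 Hu Hv (wD_L2 he2 Hw)).
have H (A B C D : R) : a * A + B + (a * C + D) = a * (A + C) + (B + D) by ring.
exact: H.
Qed.

Lemma gradip_ge0 v : 0 <= gradip O v v.
Proof. by rewrite addr_ge0// inner0_ge0. Qed.

Lemma H1_0 : H1 O 0. Proof. exact: test_H1 test_fun_0. Qed.

Lemma H1B u v : H1 O u -> H1 O v -> H1 O (u - v).
Proof. by move=> Hu Hv; rewrite addrC -scaleN1r; exact: H1_lin. Qed.

Lemma H1Z a u : H1 O u -> H1 O (a *: u).
Proof. by move=> Hu; rewrite -[a *: u]addr0; apply: H1_lin => //; exact: H1_0. Qed.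

Lemma gradip_0l w : H1 O w -> gradip O 0 w = 0.
Proof.
move=> Hw; have := gradip_lin (-1) H1_0 H1_0 Hw.
by rewrite scaler0 addr0 mulN1r addNr.
Qed.

Lemma gradipD u v w : H1 O u -> H1 O v -> H1 O w ->
  gradip O (u + v) w = gradip O u w + gradip O v w.
Proof. by move=> *; rewrite -[u]scale1r gradip_lin// mul1r scale1r. Qed.

Lemma gradipB u v w : H1 O u -> H1 O v -> H1 O w ->
  gradip O (u - v) w = gradip O u w - gradip O v w.
Proof. by move=> *; rewrite addrC -scaleN1r gradip_lin// mulN1r addrC. Qed.

Lemma gradipN u w : H1 O u -> H1 O w -> gradip O (- u) w = - gradip O u w.
Proof.
move=> Hu Hw; rewrite -sub0r gradipB//; last exact: H1_0.
by rewrite gradip_0l// sub0r.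
Qed.

Let ip1 u v := gradip O u v + inner0 O u v.

Let ip1_lin a u v w : H1 O u -> H1 O v -> H1 O w ->
  ip1 (a *: u + v) w = a * ip1 u w + ip1 v w.
Proof.
have H (A B C D : R) : a * A + B + (a * C + D) = a * (A + C) + (B + D) by ring.
move=> Hu Hv Hw; rewrite /ip1 gradip_lin// inner0_lin ?H//; exact: H1_L2.
Qed.

Let ip1C u v : ip1 u v = ip1 v u.
Proof. by rewrite /ip1 gradipC inner0C. Qed.

Let ip1_ge0 v : 0 <= ip1 v v.
Proof. by rewrite addr_ge0 ?gradip_ge0 ?inner0_ge0. Qed.

Lemma norm1_ge0 v : 0 <= norm1 O v. Proof. exact: sqrtr_ge0. Qed.

Lemma norm1_sqr v : norm1 O v ^+ 2 = gradip O v v + inner0 O v v.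
Proof. by rewrite sqr_sqrtr// ip1_ge0. Qed.

Lemma norm1_triangle u v : H1 O u -> H1 O v ->
  norm1 O (u + v) <= norm1 O u + norm1 O v.
Proof.
move=> Hu Hv; apply: (@semi_inner_triangle _ _ (H1 O) ip1) => //.
by move=> *; exact: H1_lin.
Qed.

Lemma norm1_0 : norm1 O 0 = 0.
Proof. by rewrite /norm1 gradip_0l ?inner0_0l ?addr0 ?sqrtr0//; exact: H1_0. Qed.

Lemma norm1Z a v : H1 O v -> norm1 O (a *: v) = `|a| * norm1 O v.
Proof.
move=> Hv; have HZ w : H1 O w -> ip1 (a *: v) w = a * ip1 v w.
  move=> Hw; rewrite -[a *: v]addr0 ip1_lin//; last exact: H1_0.
  by rewrite {2}/ip1 gradip_0l// inner0_0l !addr0.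
have -> : norm1 O (a *: v) = Num.sqrt (ip1 (a *: v) (a *: v)) by [].
have -> : norm1 O v = Num.sqrt (ip1 v v) by [].
rewrite (HZ _ (H1Z a Hv)) (ip1C v) (HZ _ Hv) mulrA -expr2.
by rewrite sqrtrM ?sqr_ge0// sqrtr_sqr.
Qed.

Lemma gradip_CS u v : H1 O u -> H1 O v ->
  `|gradip O u v| <= norm1 O u * norm1 O v.
Proof.
move=> Hu Hv; apply: le_trans (_ : Num.sqrt (gradip O u u) * Num.sqrt (gradip O v v) <= _).
  exact: (semi_inner_CS H1_lin gradipC gradip_lin (fun w _ => gradip_ge0 w)).
by apply: ler_pM; rewrite ?sqrtr_ge0// ler_wsqrtr// lerDl inner0_ge0.
Qed.

Lemma norm0_le_norm1 v : norm0 v <= norm1 O v.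
Proof. by rewrite ler_wsqrtr// lerDr gradip_ge0. Qed.

Lemma norm0_wD e v : e = e1 \/ e = e2 -> norm0 (wD O e v) <= norm1 O v.
Proof.
have H (A B C : R) : 0 <= A -> 0 <= B -> 0 <= C -> A <= A + B + C /\ B <= A + B + C.
  by move=> *; split; lra.
have [h1 h2] := H _ _ _ (inner0_ge0 O (wD O e1 v)) (inner0_ge0 O (wD O e2 v))
  (inner0_ge0 O v).
by case=> ->; apply: ler_wsqrtr; [exact: h1|exact: h2].
Qed.

(** A weak derivative of a null function is orthogonal to every test function. Needed since
    [supquot] leaves out the functions that vanish almost everywhere: all of those have norm 0. *)
Lemma norm1_ae_eq0 v : H1 O v -> Defs.ae_eq0 O v -> norm1 O v = 0.
Proof.
move=> Hv v0; have Lv := H1_L2 Hv.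
have H e : e = e1 \/ e = e2 -> inner0 O (wD O e v) (wD O e v) = 0.
  move=> he; have [LD HD] := wDP he Hv; apply: inner0_ae_eq0 => //.
  apply: ae_eq0_test => // phi Tphi; apply: oppr_inj; rewrite -HD// oppr0.
  by apply: inner0_ae_eq0 => //; exact/test_L2/test_fun_derive.
have E1 := H e1 (or_introl erefl); have E2 := H e2 (or_intror erefl).
rewrite /norm1 /gradip [X in X + _ + _]E1 [X in _ + X + _]E2.
by rewrite (inner0_ae_eq0 Lv Lv v0) !addr0 sqrtr0.
Qed.

Lemma H10_H1 v : H10 O v -> H1 O v. Proof. by case. Qed.

Lemma H10_0 : H10 O 0.
Proof.
split; first exact: H1_0.
by move=> eps eps0; exists 0; [exact: test_fun_0|rewrite subr0 norm1_0].
Qed.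

Lemma H10_lin a u v : H10 O u -> H10 O v -> H10 O (a *: u + v).
Proof.
move=> [Hu Au] [Hv Av]; split; first exact: H1_lin.
move=> eps eps0; have e20 : 0 < eps / 2 by rewrite divr_gt0.
(* Adding 1 keeps the divisor positive when a = 0. *)
have a1 : 0 < `|a| + 1 by rewrite ltr_wpDl.
have [phi Tphi Hphi] := Au (eps / 2 / (`|a| + 1)) (divr_gt0 e20 a1).
have [psi Tpsi Hpsi] := Av _ e20.
exists (a *: phi + psi); first exact: test_fun_lin.
have -> : a *: u + v - (a *: phi + psi) = a *: (u - phi) + (v - psi).
  by rewrite scalerBr opprD addrACA.
have H1u : H1 O (u - phi) by apply: H1B => //; exact: test_H1.
have H1v : H1 O (v - psi) by apply: H1B => //; exact: test_H1.
apply: le_lt_trans (norm1_triangle (H1Z a H1u) H1v) _.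
rewrite norm1Z// [ltRHS](splitr eps) ler_ltD//.
apply: (@le_trans _ _ ((`|a| + 1) * norm1 O (u - phi))).
  by rewrite ler_wpM2r ?norm1_ge0// lerDl.
by rewrite mulrC -ler_pdivlMr// ltW.
Qed.

Lemma H10B u v : H10 O u -> H10 O v -> H10 O (u - v).
Proof. by move=> Hu Hv; rewrite addrC -scaleN1r; exact: H10_lin. Qed.

Lemma H10N u : H10 O u -> H10 O (- u).
Proof. by rewrite -sub0r; apply: H10B; exact: H10_0. Qed.

Section Poincare.
Variable M : R.
Hypothesis OM : forall x, O x -> `|x.1| <= M.

Let xmul v : R * R -> R := (fst : R * R -> R) * v.

Let L2_xmul v : L2 O v -> L2 O (xmul v) /\ norm0 (xmul v) <= M * norm0 v.
Proof.
move=> [mv iv].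
have mx : measurable_fun O (xmul v : plane -> R).
  apply: (@measurable_funM _ _ _ _ (fst : plane -> R)) => //.
  by apply: measurable_funTS; exact: measurable_fst.
have le x : O x -> xmul v x ^+ 2 <= M ^+ 2 * v x ^+ 2.
  move=> Ox; rewrite -[xmul v x]/(x.1 * v x) exprMn ler_wpM2r ?sqr_ge0//.
  by rewrite -[x.1 ^+ 2]real_normK ?num_real// lerXn2r ?nnegrE ?(le_trans _ (OM Ox)) ?OM.
have ix : mu.-integrable O (fun x => (xmul v x ^+ 2)%:E).
  apply: (@integrable_le _ O mO (fun x => xmul v x ^+ 2) (fun x => M ^+ 2 * v x ^+ 2)).
  - exact: measurable_funX.
  - by move=> x Ox; rewrite ger0_norm ?sqr_ge0// le.
  - exact: (integrableZl mO (M ^+ 2) iv).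
have Lx : L2 O (xmul v) by [].
(* M >= 0 needs a point of [O]; on the empty set both norms are 0. *)
split=> //; have [[x Ox]|] := pselect (O !=set0); last first.
  move=> /set0P/negP; rewrite negbK => /eqP O0.
  by rewrite /norm0 /inner0 O0 !Rintegral_set0 sqrtr0 mulr0.
have M0 : 0 <= M by apply: le_trans (OM Ox).
rewrite -[M]ger0_norm// -sqrtr_sqr -sqrtrM ?sqr_ge0// ler_wsqrtr//.
have ivv := L2_mul mO (conj mv iv : L2 O v) (conj mv iv : L2 O v).
rewrite /inner0 -RintegralZl//; apply: le_Rintegral => //.
exact: (integrableZl mO (M ^+ 2) ivv).
Qed.

Lemma poincare_test v phi : H1 O v -> test_fun O phi ->
  inner0 O v phi + inner0 O v (xmul (fun x => 'D_e1 phi x)) =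
  - inner0 O (wD O e1 v) (xmul phi).
Proof.
move=> Hv Tphi; have he : @e1 R = e1 \/ @e1 R = e2 by left.
have [LD HD] := wDP he Hv.
have TD := test_fun_derive Tphi he.
have Tx : test_fun O (xmul phi) by apply: test_fun_mul => // k; exact: Ck_fst.
rewrite -HD// ![inner0 O v _]inner0C -inner0D; last first.
- exact: H1_L2.
- by have [] := L2_xmul (test_L2 mO TD).
- exact: test_L2.
congr (inner0 O _ v); apply/funext => x; have [Cphi _] := Tphi.
have := is_deriveM (is_derive_fst x e1) (Ck_is_derive x (Cphi 1) he).
move=> [_ ->]; rewrite /= [phi x *: _]mulr1 addrC.
by [].
Qed.

(** With a = ||v||_0 and b = ||d1 v||_0, the tested identity gives a^2 <= 2 M a b in the limit;
    dividing by a and squaring produces the factor 4 M^2. *)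
Lemma poincare v : H10 O v -> inner0 O v v <= 4 * M ^+ 2 * gradip O v v.
Proof.
move=> [Hv Av]; have Lv := H1_L2 Hv; have he : @e1 R = e1 \/ @e1 R = e2 by left.
set D := wD O e1 v; have LD : L2 O D by exact: wD_L2.
set a := norm0 v; set b := norm0 D.
have a0 : 0 <= a by exact: sqrtr_ge0.
have b0 : 0 <= b by exact: sqrtr_ge0.
have aE : inner0 O v v = a ^+ 2 by rewrite sqr_sqrtr// inner0_ge0.
have nb2 : b ^+ 2 <= gradip O v v.
  by rewrite sqr_sqrtr ?inner0_ge0// lerDl inner0_ge0.
have [EO|nEO] := eqVneq O set0.
  have Z u w : inner0 O u w = 0 by rewrite /inner0 EO Rintegral_set0.
  by rewrite Z mulr_ge0 ?gradip_ge0// mulr_ge0// sqr_ge0.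
have M0 : 0 <= M by have /set0P[x Ox] := nEO; apply: le_trans (OM Ox).
(* Each replacement of [phi] by [v], or of its derivative by [D], costs at most eps times a, M a or
   M b. *)
have main eps : 0 < eps -> a ^+ 2 <= 2 * M * a * b + eps * (a + M * a + M * b).
  move=> eps0; have [phi Tphi Hphi] := Av _ eps0.
  have Lphi := test_L2 mO Tphi; have Hphi1 := test_H1 mO Tphi.
  have TD := test_fun_derive Tphi he; have LTD := test_L2 mO TD.
  have [Lx nx] := L2_xmul Lphi; have [LxD nxD] := L2_xmul LTD.
  have Hd : H1 O (v - phi) by exact: H1B.
  have Ld := H1_L2 Hd.
  have nd : norm0 (v - phi) < eps by apply: le_lt_trans Hphi; exact: norm0_le_norm1.
  have h1 : a ^+ 2 - inner0 O v phi <= a * eps.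
    rewrite -aE (inner0C O v phi) -inner0B// inner0C.
    apply: le_trans (ler_norm _) _; apply: le_trans (inner0_CS Lv Ld) _.
    by rewrite ler_wpM2l// ltW.
  have nphi : norm0 phi <= a + eps.
    have -> : phi = v + (-1) *: (v - phi) by rewrite scaleN1r opprB addrC subrK.
    apply: le_trans (norm0_triangle Lv (L2Z _ Ld)) _; rewrite lerD2l.
    rewrite /norm0 inner0Z//; last exact: L2Z.
    by rewrite inner0C inner0Z// !mulN1r opprK ltW.
  have nDphi : norm0 (fun x => 'D_e1 phi x) <= b + eps.
    set Dphi := (fun x => _) in LTD *.
    set E := wD O e1 (v - phi); have LE : L2 O E by exact: wD_L2.
    have nE : norm0 E < eps by apply: le_lt_trans Hphi; exact: norm0_wD.
    (* [Dphi] is the classical derivative of [phi] and D - E represents its weak derivative, so they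
       agree once paired with an L2 function. *)
    have EE w : L2 O w -> inner0 O Dphi w = inner0 O (D - E) w.
      move=> Lw; rewrite inner0B//.
      have -> : inner0 O E w = - inner0 O (wD O e1 phi) w + inner0 O D w.
        rewrite /E (_ : v - phi = -1 *: phi + v); last by rewrite scaleN1r addrC.
        by rewrite wD_lin// mulN1r.
      apply: etrans (weak_deriv_unique (test_weak_deriv mO Tphi he) (wDP he Hphi1) Lw) _.
      have H (P Q : R) : P = Q - (- P + Q) by ring.
      exact: H.
    have LDE : L2 O (D - E) by exact: L2B.
    have -> : norm0 Dphi = norm0 (D - E).
      by rewrite /norm0 EE// inner0C EE.
    rewrite -[- E]scaleN1r.
    apply: le_trans (norm0_triangle LD (L2Z _ LE)) _; rewrite lerD2l.
    rewrite /norm0 inner0Z//; last exact: L2Z.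
    by rewrite inner0C inner0Z// !mulN1r opprK ltW.
  have P := poincare_test Hv Tphi.
  have h2 : - inner0 O v (xmul (fun x => 'D_e1 phi x)) <= M * a * (b + eps).
    apply: le_trans (ler_norm _) _; rewrite normrN.
    apply: le_trans (inner0_CS Lv LxD) _.
    apply: le_trans (ler_wpM2l a0 (le_trans nxD (ler_wpM2l M0 nDphi))) _.
    by rewrite mulrA (mulrC a).
  have h3 : - inner0 O D (xmul phi) <= M * b * (a + eps).
    apply: le_trans (ler_norm _) _; rewrite normrN.
    apply: le_trans (inner0_CS LD Lx) _.
    apply: le_trans (ler_wpM2l b0 (le_trans nx (ler_wpM2l M0 nphi))) _.
    by rewrite mulrA (mulrC b).
  by rewrite -/D in P; nra.
have ab : a ^+ 2 <= 2 * M * a * b.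
  set S := a + M * a + M * b in main.
  have S0 : 0 <= S by rewrite !addr_ge0// mulr_ge0.
  apply/ler_addgt0Pr => e e0.
  (* S may be 0, hence S + 1. *)
  have := main (e / (S + 1)) (divr_gt0 e0 (ltr_wpDl S0 ltr01)).
  move=> /le_trans; apply; rewrite lerD2l mulrAC ler_pdivrMr ?ltr_wpDl//.
  by rewrite ler_wpM2l ?lerDl// ltW.
have ab' : a <= 2 * M * b.
  have [->|an0] := eqVneq a 0; first by rewrite !mulr_ge0.
  have ap : 0 < a by rewrite lt_neqAle eq_sym an0.
  by rewrite -(ler_pM2r ap) -expr2 (le_trans ab)// mulrAC.
rewrite aE; apply: (@le_trans _ _ ((2 * M * b) ^+ 2)).
  by rewrite lerXn2r ?nnegrE// !mulr_ge0.
rewrite (_ : (2 * M * b) ^+ 2 = 4 * M ^+ 2 * b ^+ 2); last by ring.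
by rewrite ler_wpM2l// mulr_ge0// sqr_ge0.
Qed.

End Poincare.

End Sobolev.

(** * Dual norms *)

Section RealAlgebra.
Variable R : realFieldType.
Implicit Types (A B E D S K b : R).

(** E and D stand for the errors of [uh] and [lamh], A and B for the approximation errors of the two
    variables, S for the square root term and b for 1/beta. In terms of T = A + B + S, eliminating D
    leaves E^2 <= k (E T + T^2) with k = K (2 + b). *)
Lemma error_absorption K b E A D B S : 1 <= K -> 0 <= b ->
  0 <= E -> 0 <= A -> 0 <= D -> 0 <= B -> 0 <= S ->
  D <= B + b * (B + E) ->
  E ^+ 2 <= K * (E * A + D * A + B * E + S ^+ 2) ->
  E + D <= (1 + b) * (2 * (K * (2 + b)) + 1) * (A + B + S).
Proof.
move=> K1 b0 E0 A0 D0 B0 S0 HD HE.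
set T := A + B + S; have T0 : 0 <= T by rewrite !addr_ge0.
have AT : A <= T by rewrite /T; lra.
have BT : B <= T by rewrite /T; lra.
have ST : S <= T by rewrite /T; lra.
have DT : D <= (1 + b) * T + b * E.
  apply: le_trans HD _.
  have := ler_wpM2l b0 BT; lra.
set k := K * (2 + b).
have k1 : 1 <= k by rewrite /k; have := mulr_ge0 (le_trans ler01 K1) b0; lra.
have HE2 : E ^+ 2 <= k * (E * T) + k * (T * T).
  apply: le_trans HE _.
  have h1 := ler_wpM2l E0 AT.
  have h2 : D * A <= ((1 + b) * T + b * E) * T by apply: ler_pM => //.
  have h3 : B * E <= T * E by rewrite ler_wpM2r.
  have h4 : S ^+ 2 <= T * T by rewrite expr2; apply: ler_pM.
  have -> : k * (E * T) + k * (T * T) =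
    K * (E * T + ((1 + b) * T + b * E) * T + T * E + T * T) by rewrite /k; ring.
  rewrite ler_wpM2l ?(le_trans ler01)//; lra.
have ET : E <= 2 * k * T.
  (* If E > 2 k T, then T <= E because k >= 1, and E^2 <= k E T + k T^2 <= 2 k T E < E^2. *)
  rewrite leNgt; apply/negP => H.
  have TE : T <= E.
    apply: le_trans (ltW H); rewrite -[leLHS]mul1r; apply: ler_wpM2r => //; lra.
  have Ep : 0 < E.
    apply: le_lt_trans H; apply: mulr_ge0 => //; lra.
  have h1 : T * T <= E * T by rewrite ler_wpM2r.
  have h2 := ler_wpM2l (le_trans ler01 k1) h1.
  have h3 : 2 * k * T * E < E * E by rewrite ltr_pM2r.
  move: HE2; rewrite expr2 => HE2.
  have E1 : 2 * k * T * E = k * (E * T) + k * (E * T) by ring.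
  lra.
apply: (@le_trans _ _ ((1 + b) * E + (1 + b) * T)); first lra.
rewrite -mulrDr -mulrA ler_wpM2l//; first lra.
by rewrite mulrDl mul1r lerD2r.
Qed.

Lemma error_energy (ee a1 a2 lu luh lvh iu iuh ivh gi ju juh jg A B E D : R) :
  ee = a1 + a2 -> a1 <= E * A ->
  a2 = (lvh - luh) - (ivh - iuh) ->
  - ((lu - lvh) - (iu - ivh)) <= D * A ->
  gi <= iu -> iuh = gi ->
  (lu - luh) - (ju - juh) <= B * E -> jg <= juh ->
  ee <= E * A + D * A + B * E + (ju - jg).
Proof. by move=> *; lra. Qed.

End RealAlgebra.

(** * The H^{-1} norm, its pairing and the cone of multipliers *)

Section DualNorm.
Context {R : realType}.
Local Notation plane := (measurableTypeR R * measurableTypeR R)%type.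
Local Notation mu := (@mu2 R).
Variables (O : set (R * R)) (oO : open O).
Implicit Types (u v w m : R * R -> R) (xi eta : (R * R -> R) -> R).
Let mO : measurable (O : set plane).
Proof. exact: open_measurable_plane. Qed.

(** The condition [0 <= c] accounts for two conventions: an empty supremum is 0, and so is a
    quotient by a zero norm. *)
Lemma supquot_le W xi c : 0 <= c ->
  (forall v, W v -> pairing v xi <= c * norm1 O v) -> supquot O W xi <= c.
Proof.
move=> c0 H; rewrite /supquot; set S := [set r | _].
have [->|/set0P Sn] := eqVneq S set0; first by rewrite sup0.
apply: ge_sup => // _ [v [Wv _ ->]].
have [->|n0] := eqVneq (norm1 O v) 0; first by rewrite invr0 mulr0.
by rewrite ler_pdivrMr ?H// lt_neqAle eq_sym n0 norm1_ge0.
Qed.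

Lemma Hm1_0 xi : Hm1 O xi -> xi 0 = 0.
Proof.
move=> [L _]; have := L (-1) 0 0 (H10_0 oO) (H10_0 oO).
by rewrite scaler0 addr0 /pairing mulN1r addNr.
Qed.

Lemma Hm1Z xi a v : Hm1 O xi -> H10 O v -> xi (a *: v) = a * xi v.
Proof.
move=> Hxi Hv; have [L _] := Hxi.
have := L a v 0 Hv (H10_0 oO); rewrite addr0 /pairing => ->.
by rewrite (Hm1_0 Hxi) addr0.
Qed.

Lemma Hm1N xi v : Hm1 O xi -> H10 O v -> xi (- v) = - xi v.
Proof. by move=> Hxi Hv; rewrite -scaleN1r (Hm1Z _ Hxi Hv) mulN1r. Qed.

Lemma Hm1_sub xi v w : Hm1 O xi -> H10 O v -> H10 O w ->
  xi (v - w) = xi v - xi w.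
Proof.
move=> Hxi Hv Hw; have [L _] := Hxi.
have := L (-1) w v Hw Hv; rewrite scaleN1r addrC /pairing => ->.
by rewrite mulN1r addrC.
Qed.

Lemma norm1N v : H1 O v -> norm1 O (- v) = norm1 O v.
Proof. by move=> Hv; rewrite -scaleN1r norm1Z// normrN normr1 mul1r. Qed.

Let quots xi := [set r : R | exists v,
  [/\ H10 O v, ~ Defs.ae_eq0 O v & r = pairing v xi / norm1 O v]].

Let has_ubound_quots xi : Hm1 O xi -> has_ubound (quots xi).
Proof.
(* The maximum with 0 covers functions of norm 0, whose quotient is 0. *)
move=> [_ [M HM]]; exists (Num.max M 0) => _ [v [Hv _ ->]].
have [->|n0] := eqVneq (norm1 O v) 0; first by rewrite invr0 mulr0 le_max lexx orbT.
have np : 0 < norm1 O v by rewrite lt_neqAle eq_sym n0 norm1_ge0.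
rewrite ler_pdivrMr//; apply: le_trans (ler_norm _) _.
apply: le_trans (HM _ Hv) _; rewrite ler_pM2r//.
by rewrite le_max lexx.
Qed.

(** If [v] has norm 0, boundedness of [xi] settles the claim; otherwise [v] is not null and its
    quotient takes part in the supremum. *)
Lemma pairing_le xi v : Hm1 O xi -> H10 O v ->
  xi v <= normm1 O xi * norm1 O v.
Proof.
move=> Hxi Hv; have [n0|n0] := eqVneq (norm1 O v) 0.
  have [_ [M HM]] := Hxi; have := HM _ Hv; rewrite n0 !mulr0 => H.
  exact: le_trans (ler_norm _) H.
have np : 0 < norm1 O v by rewrite lt_neqAle eq_sym n0 norm1_ge0.
rewrite -ler_pdivrMr//; apply: ub_le_sup; first exact: has_ubound_quots.
exists v; split => // v0.
by move: n0; rewrite (norm1_ae_eq0 oO (H10_H1 Hv) v0) eqxx.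
Qed.

Lemma pairing_le_norm xi v : Hm1 O xi -> H10 O v ->
  `|xi v| <= normm1 O xi * norm1 O v.
Proof.
move=> Hxi Hv; rewrite ler_norml lerNl pairing_le// andbT.
by rewrite -(Hm1N Hxi Hv) -(norm1N (H10_H1 Hv)) pairing_le//; exact: H10N.
Qed.

(** [v] and [- v] contribute opposite quotients, and the supremum of the empty set is 0. *)
Lemma normm1_ge0 xi : Hm1 O xi -> 0 <= normm1 O xi.
Proof.
move=> Hxi; rewrite /normm1 /supquot -/(quots xi).
have [->|/set0P[_ [v [Hv nv _]]]] := eqVneq (quots xi) set0; first by rewrite sup0.
have ub := has_ubound_quots Hxi.
have h1 : pairing v xi / norm1 O v <= sup (quots xi).
  by apply: ub_le_sup => //; exists v.
have h2 : - (pairing v xi / norm1 O v) <= sup (quots xi).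
  apply: ub_le_sup => //; exists (- v); split; first exact: H10N.
    move=> H; apply: nv; move: H; apply: negligibleS => x /=.
    apply: contra_not => H Ox; apply: oppr_inj; rewrite oppr0.
    exact: H.
  by rewrite (norm1N (H10_H1 Hv)) /pairing (Hm1N Hxi Hv) mulNr.
move: h1 h2; set r := _ / _; set s := sup _; lra.
Qed.

Lemma Hm1_B xi eta : Hm1 O xi -> Hm1 O eta -> Hm1 O (xi - eta).
Proof.
move=> [L1 [M1 B1]] [L2 [M2 B2]]; split.
  move=> a v w Hv Hw; have := L1 a v w Hv Hw; have := L2 a v w Hv Hw.
  rewrite /pairing => E1 E2.
  rewrite -[LHS]/(xi (a *: v + w) - eta (a *: v + w)) E1 E2.
  rewrite -[(xi - eta) v]/(xi v - eta v) -[(xi - eta) w]/(xi w - eta w).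
  by move: (xi v) (xi w) (eta v) (eta w) => *; ring.
exists (M1 + M2) => v Hv; rewrite mulrDl.
apply: le_trans (ler_normB (xi v) (eta v)) _.
exact: lerD (B1 _ Hv) (B2 _ Hv).
Qed.

Lemma Lam_0 : Lam O 0.
Proof.
split; last by move=> v _ _; exact: lexx.
split; first by move=> a v w _ _; rewrite /pairing/= mulr0 addr0.
by exists 0 => v _; rewrite /pairing normr0 mul0r.
Qed.

Lemma Lam_D xi eta : Lam O xi -> Lam O eta -> Lam O (xi + eta).
Proof.
move=> [[L1 [M1 B1]] P1] [[L2 [M2 B2]] P2]; split; last first.
  by move=> v Hv v0; apply: addr_ge0; [exact: P1|exact: P2].
split.
  move=> a v w Hv Hw; have := L1 a v w Hv Hw; have := L2 a v w Hv Hw.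
  rewrite /pairing => E1 E2.
  rewrite -[LHS]/(xi (a *: v + w) + eta (a *: v + w)) E1 E2.
  rewrite -[(xi + eta) v]/(xi v + eta v) -[(xi + eta) w]/(xi w + eta w).
  by move: (xi v) (xi w) (eta v) (eta w) => *; ring.
exists (M1 + M2) => v Hv; rewrite mulrDl.
apply: le_trans (ler_normD (xi v) (eta v)) _.
exact: lerD (B1 _ Hv) (B2 _ Hv).
Qed.

Lemma H10_L2 v : H10 O v -> L2 O v. Proof. by move=> /H10_H1/H1_L2. Qed.

Lemma Hm1_L2dual m : L2 O m -> Hm1 O (L2dual O m).
Proof.
move=> Lm; split.
  by move=> a v w Hv Hw; rewrite /pairing /L2dual inner0_lin//; exact: H10_L2.
exists (norm0 O m) => v Hv; apply: le_trans (inner0_CS oO (H10_L2 Hv) Lm) _.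
by rewrite mulrC ler_wpM2l ?sqrtr_ge0// norm0_le_norm1.
Qed.

(** Both factors are nonnegative only almost everywhere, so the integrand is first replaced by its
    absolute value. *)
Lemma inner0_ae_ge0 v m : L2 O v -> L2 O m -> ae_ge0 O v -> ae_ge0 O m ->
  0 <= inner0 O v m.
Proof.
move=> Lv Lm v0 m0; have [mv _] := Lv; have [mm _] := Lm.
have mvm : measurable_fun O ((v \* m) : plane -> R) by exact: measurable_funM.
rewrite /inner0 /Rintegral.
have -> : (\int[mu]_(x in O) (v x * m x)%:E = \int[mu]_(x in O) `|v x * m x|%:E)%E.
  apply: ae_eq_integral => //; first exact/measurable_EFinP.
    by apply/measurable_EFinP; exact: measurableT_comp.
  apply: negligibleS (negligibleU v0 m0) => x /= H; apply: contrapT.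
  move=> /not_orP[/contrapT h1 /contrapT h2].
  by apply: H => Ox; rewrite ger0_norm// mulr_ge0 ?h1 ?h2.
by apply: fine_ge0; apply: integral_ge0 => x _; rewrite lee_fin.
Qed.

Lemma Lam_L2dual m : L2 O m -> ae_ge0 O m -> Lam O (L2dual O m).
Proof.
move=> Lm m0; split; first exact: Hm1_L2dual.
by move=> v Hv v0; apply: inner0_ae_ge0 => //; exact: H10_L2.
Qed.

End DualNorm.

(** * The continuous and the discrete problem *)

(** Convex weights are at most 1, so the sum of |x1| over the generating points is a bound. *)
Lemma chull_fst_bound (R : realType) (s : seq (R * R)) : exists M : R,
  forall x, chull s x -> `|x.1| <= M.
Proof.
exists (\sum_i `|(tnth (in_tuple s) i).1|) => x [a [a0 a1 ->]].
have -> : (\sum_i a i *: tnth (in_tuple s) i).1 =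
    \sum_i a i * (tnth (in_tuple s) i).1.
  exact: (big_morph (fst : R * R -> R) (id1 := 0) (op1 := +%R)).
apply: le_trans (ler_norm_sum _ _ _) _; apply: ler_sum => i _.
rewrite normrM ger0_norm// -[leRHS]mul1r ler_wpM2r// -a1 (bigD1 i)//= lerDl.
exact: sumr_ge0.
Qed.

Section ObstacleProblem.
Context {R : realType}.
Local Notation plane := (measurableTypeR R * measurableTypeR R)%type.
Variables (O : set (R * R)) (oO : open O).
Variables (f g u : R * R -> R) (lam : (R * R -> R) -> R).
Hypotheses (Lf : L2 O f) (Lg : L2 O g) (us : obstacle_sol O f g u lam).
Let mO : measurable (O : set plane).
Proof. exact: open_measurable_plane. Qed.

(** Taking [m = lam] removes the terms in [m - lam] and leaves an inequality in [v], which for [v]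
    and [- v] together is an equality. *)
Lemma obstacle_galerkin v : H10 O v -> gradip O u v - lam v = inner0 O f v.
Proof.
move: us => [Hu Llam Hs] Hv; have [Hlam _] := Llam.
have key w : H10 O w -> gradip O u w - lam w <= inner0 O f w.
  move=> Hw; have := Hs w lam Hw Llam; rewrite /Bform /Lform /pairing.
  rewrite -![(lam - lam) _]/(lam _ - lam _).
  by rewrite subrr subr0 [X in _ <= _ - X]subrr subr0.
apply/eqP; rewrite eq_le key//=.
have := key _ (H10N oO Hv); rewrite (Hm1N oO Hlam Hv).
rewrite (gradipC O u (- v)) (gradipN oO (H10_H1 Hv) (H10_H1 Hu)) (gradipC O v u).
rewrite -[X in inner0 O f X]scaleN1r (inner0C O f (_ *: _)).
rewrite (inner0Z oO _ (H10_L2 Hv) Lf) mulN1r (inner0C O v f).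
by rewrite -opprD lerN2.
Qed.

Lemma obstacle_compl m : Lam O m -> m g - lam g <= m u - lam u.
Proof.
move: us => [Hu Llam Hs] Lm; have [Hlam _] := Llam.
have := Hs 0 m (H10_0 oO) Lm; rewrite /Bform /Lform /pairing.
rewrite (Hm1_0 oO Hlam) (gradipC O u 0) (gradip_0l oO (H10_H1 Hu)).
rewrite (inner0C O f 0) inner0_0l.
rewrite -[(m - lam) u]/(m u - lam u) -[(m - lam) g]/(m g - lam g).
by rewrite subr0 !sub0r lerN2.
Qed.

(* Not stated as [lam (u - g) = 0]: [lam] need not be additive outside of
   [H10 O], and membership of [g] in [H10 O] is not at hand. *)
Lemma obstacle_contact : lam u = lam g.
Proof.
move: us => [Hu Llam Hs].
have h1 := obstacle_compl (Lam_0 O).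
have h2 := obstacle_compl (Lam_D Llam Llam).
move: h1 h2.
rewrite -[(lam + lam) g]/(lam g + lam g) -[(lam + lam) u]/(lam u + lam u).
rewrite -[(0 : (R * R -> R) -> R) g]/(0 : R) -[(0 : (R * R -> R) -> R) u]/(0 : R).
by move: (lam u) (lam g) => x y h1 h2; apply/eqP; rewrite eq_le; apply/andP; split; lra.
Qed.

(** Weak form of u >= g: a nonnegative L2 function is an admissible multiplier, and the terms in
    [lam] cancel by the contact identity. *)
Lemma obstacle_above m : L2 O m -> ae_ge0 O m -> inner0 O g m <= inner0 O u m.
Proof.
move=> Lm m0; have := obstacle_compl (Lam_L2dual oO Lm m0).
by rewrite obstacle_contact lerD2r.
Qed.

End ObstacleProblem.

Section DiscreteProblem.
Context {R : realType}.
Local Notation plane := (measurableTypeR R * measurableTypeR R)%type.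
Variables (O : set (R * R)) (oO : open O).
Variables (f g : R * R -> R) (Vh Qh : set (R * R -> R)) (uh lamh : R * R -> R).
Hypotheses (Lf : L2 O f) (Lg : L2 O g).
Hypotheses (Vh0 : Vh 0) (Vh_lin : forall a v w, Vh v -> Vh w -> Vh (a *: v + w)).
Hypotheses (Qh0 : Qh 0) (Qh_lin : forall a v w, Qh v -> Qh w -> Qh (a *: v + w)).
Hypotheses (VhH : Vh `<=` H10 O) (QhL : Qh `<=` L2 O).
Hypothesis (hs : mixed_fem_sol O f g Vh Qh uh lamh).
Let mO : measurable (O : set plane).
Proof. exact: open_measurable_plane. Qed.

Lemma fem_galerkin v : Vh v -> gradip O uh v - inner0 O v lamh = inner0 O f v.
Proof.
move: hs => [Vuh [Qlamh plamh] Hs] Vv; have Llamh := QhL Qlamh.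
have Hv := VhH Vv; have Huh := VhH Vuh.
have Z0 w : inner0 O w (lamh - lamh) = 0 by rewrite subrr inner0C inner0_0l.
have key w : Vh w -> gradip O uh w - inner0 O w lamh <= inner0 O f w.
  move=> Vw; have := Hs w lamh Vw (conj Qlamh plamh).
  by rewrite /Bform /Lform /pairing /L2dual !Z0 !subr0.
apply/eqP; rewrite eq_le key//=.
have := key _ (Vh_lin (-1) Vv Vh0); rewrite addr0.
rewrite (inner0Z oO _ (H10_L2 Hv) Llamh) mulN1r.
rewrite (inner0C O f (_ *: _)) (inner0Z oO _ (H10_L2 Hv) Lf) mulN1r (inner0C O v f).
rewrite scaleN1r (gradipC O uh (- v)) (gradipN oO (H10_H1 Hv) (H10_H1 Huh)).
by rewrite (gradipC O v uh) -opprD lerN2.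
Qed.

Lemma fem_compl m : Lamh O Qh m ->
  inner0 O g (m - lamh) <= inner0 O uh (m - lamh).
Proof.
move: hs => [Vuh Llamh Hs] Lm; have Huh := VhH Vuh.
have := Hs 0 m Vh0 Lm; rewrite /Bform /Lform /pairing /L2dual !inner0_0l.
rewrite (gradipC O uh 0) (gradip_0l oO (H10_H1 Huh)) (inner0C O f 0) inner0_0l.
by rewrite subr0 !sub0r lerN2.
Qed.

Lemma inner0_subr v m1 m2 : L2 O v -> L2 O m1 -> L2 O m2 ->
  inner0 O v (m1 - m2) = inner0 O v m1 - inner0 O v m2.
Proof.
move=> Lv L1 L2; rewrite inner0C (inner0B oO L1 L2 Lv).
by rewrite (inner0C O m1) (inner0C O m2).
Qed.

Lemma fem_contact : inner0 O uh lamh = inner0 O g lamh.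
Proof.
move: hs => [Vuh [Qlamh plamh] Hs]; have Llamh := QhL Qlamh.
have Luh := H10_L2 (VhH Vuh).
have L0 : Lamh O Qh 0 by split => //; apply: aeW => x _; exact: lexx.
have L2h : Lamh O Qh (lamh + lamh).
  split; first by rewrite -[X in X + _]scale1r; exact: Qh_lin.
  apply: negligibleS plamh => x /=; apply: contra_not => H Ox.
  by apply: addr_ge0; exact: H.
have h1 := fem_compl L0; have h2 := fem_compl L2h.
move: h1 h2; rewrite addrK !(inner0_subr _ (L2_0 oO) Llamh)//.
rewrite !(inner0C O _ 0) !inner0_0l !sub0r lerN2 => h1 h2.
by apply/eqP; rewrite eq_le h1 h2.
Qed.

(** Discrete substitute for uh >= g, which need not hold pointwise: it is available only against
    Lambda_h. *)
Lemma fem_above m : Lamh O Qh m -> inner0 O g m <= inner0 O uh m.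
Proof.
move=> Lm; have [Vuh [Qlamh _] _] := hs; have [Qm _] := Lm.
have := fem_compl Lm.
rewrite !(inner0_subr _ (QhL Qm) (QhL Qlamh))//; last exact/H10_L2/VhH.
by rewrite fem_contact lerD2r.
Qed.

End DiscreteProblem.

(** * The error estimate *)

Section ErrorEstimate.
Context {R : realType}.
Local Notation plane := (measurableTypeR R * measurableTypeR R)%type.
Variables (O : set (R * R)) (oO : open O) (M : R).
Hypothesis OM : forall x, O x -> `|x.1| <= M.
Variables (beta : R) (f g u : R * R -> R) (lam : (R * R -> R) -> R).
Variables (Vh Qh : set (R * R -> R)) (uh lamh : R * R -> R).
Hypotheses (beta0 : 0 < beta).
Hypotheses (Lf : L2 O f) (Lg : L2 O g) (us : obstacle_sol O f g u lam).
Hypotheses (Vh0 : Vh 0) (Vh_lin : forall a v w, Vh v -> Vh w -> Vh (a *: v + w)).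
Hypotheses (Qh0 : Qh 0) (Qh_lin : forall a v w, Qh v -> Qh w -> Qh (a *: v + w)).
Hypotheses (VhH : Vh `<=` H10 O) (QhL : Qh `<=` L2 O).
Hypotheses (BB : babuska_brezzi O beta Vh Qh).
Hypothesis (hs : mixed_fem_sol O f g Vh Qh uh lamh).
Let mO : measurable (O : set plane).
Proof. exact: open_measurable_plane. Qed.

Let Hu : H10 O u. Proof. by case: us. Qed.
Let Huh : H10 O uh. Proof. by apply: VhH; case: hs. Qed.
Let He : H10 O (u - uh). Proof. exact: H10B. Qed.
Let Hlam : Hm1 O lam. Proof. by case: us => _ []. Qed.
Let Qlamh : Qh lamh. Proof. by case: hs => _ []. Qed.
Let plamh : ae_ge0 O lamh. Proof. by case: hs => _ []. Qed.
Let Llamh : L2 O lamh. Proof. exact: QhL. Qed.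

Let Hdiff m : L2 O m -> Hm1 O (lam - L2dual O m).
Proof. by move=> Lm; apply: Hm1_B => //; exact: Hm1_L2dual. Qed.

Lemma error_orthogonality w : Vh w ->
  gradip O (u - uh) w = lam w - inner0 O w lamh.
Proof.
move=> Vw; have Hw := VhH Vw.
rewrite (gradipB oO (H10_H1 Hu) (H10_H1 Huh) (H10_H1 Hw)).
have := obstacle_galerkin oO Lf us Hw.
have := fem_galerkin oO Lf Vh0 Vh_lin VhH QhL hs Vw => <-.
move: (gradip O u w) (gradip O uh w) (lam w) (inner0 O w lamh) => *; lra.
Qed.

(** The estimate passes through [m - lamh], which may leave the cone but stays in the linear space
    [Qh], where the inf-sup condition applies. Its pairing with w splits at [lam] into an
    approximation error and, by orthogonality, an energy term. *)
Lemma multiplier_error m : Qh m ->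
  normm1 O (lam - L2dual O lamh) <= normm1 O (lam - L2dual O m) +
    beta^-1 * (normm1 O (lam - L2dual O m) + norm1 O (u - uh)).
Proof.
move=> Qm; have Lm := QhL Qm.
set B := normm1 O (lam - L2dual O m); set E := norm1 O (u - uh).
have B0 : 0 <= B := normm1_ge0 oO (Hdiff Lm).
have E0 : 0 <= E := norm1_ge0 _ _.
have Qxi : Qh (m - lamh) by rewrite addrC -scaleN1r; exact: Qh_lin.
have Lxi : L2 O (m - lamh) := QhL Qxi.
have stab : normm1 O (L2dual O (m - lamh)) <= beta^-1 * (B + E).
  rewrite ler_pdivlMl//; apply: le_trans (BB Qxi) _.
  apply: supquot_le => [|w Vw]; first exact: addr_ge0.
  have Hw := VhH Vw.
  rewrite /pairing /L2dual (inner0_subr oO (H10_L2 Hw) Lm Llamh).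
  have h1 : - (lam w - inner0 O w m) <= B * norm1 O w.
    have := pairing_le_norm oO (Hdiff Lm) Hw.
    by rewrite ler_norml => /andP[+ _]; rewrite lerNl.
  have h2 : lam w - inner0 O w lamh <= E * norm1 O w.
    rewrite -error_orthogonality//; apply: le_trans (ler_norm _) _.
    by apply: gradip_CS => //; exact: H10_H1.
  rewrite mulrDl; have tri (a b c x y : R) : - (a - b) <= x -> a - c <= y -> b - c <= x + y.
    by move=> *; lra.
  exact: tri h1 h2.
apply: le_trans (_ : B + normm1 O (L2dual O (m - lamh)) <= _); last by rewrite lerD2l.
have Hxi := Hm1_L2dual oO Lxi.
apply: supquot_le => [|v Hv]; first by rewrite addr_ge0// normm1_ge0.
have h1 : lam v - inner0 O v m <= B * norm1 O v := pairing_le oO (Hdiff Lm) Hv.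
have h2 : inner0 O v (m - lamh) <= normm1 O (L2dual O (m - lamh)) * norm1 O v :=
  pairing_le oO Hxi Hv.
rewrite (inner0_subr oO (H10_L2 Hv) Lm Llamh) in h2.
rewrite /pairing mulrDl -[(lam - L2dual O lamh) v]/(lam v - inner0 O v lamh).
have tri (a b c x y : R) : a - b <= x -> b - c <= y -> a - c <= x + y.
  by move=> *; lra.
exact: tri h1 h2.
Qed.

(** The error is split at [v]: orthogonality handles v - uh, which lies in [Vh], and Cauchy-Schwarz
    handles u - v. *)
Lemma energy_error v m : Vh v -> Lamh O Qh m ->
  gradip O (u - uh) (u - uh) <= norm1 O (u - uh) * norm1 O (u - v)
    + normm1 O (lam - L2dual O lamh) * norm1 O (u - v)
    + normm1 O (lam - L2dual O m) * norm1 O (u - uh)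
    + Num.sqrt (pairing (u - g) (L2dual O m)) ^+ 2.
Proof.
move=> Vv [Qm pm]; have Lm := QhL Qm; have Hv := VhH Vv.
have Vuh : Vh uh by case: hs.
have Lu := H10_L2 Hu; have Luh := H10_L2 Huh; have Lv := H10_L2 Hv.
have Huv : H10 O (u - v) by exact: H10B.
have Vw : Vh (v - uh) by rewrite addrC -scaleN1r; exact: Vh_lin.
have Hw := VhH Vw.
(* Squaring undoes the square root because <u - g, m> >= 0, by the weak form of u >= g. *)
have hS : inner0 O u m - inner0 O g m <= Num.sqrt (pairing (u - g) (L2dual O m)) ^+ 2.
  rewrite /pairing /L2dual (inner0B oO Lu Lg Lm) sqr_sqrtr// subr_ge0.
  exact: (obstacle_above oO us).
apply: le_trans (lerD (lexx _) hS).
apply: (error_energy (a1 := gradip O (u - uh) (u - v))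
  (a2 := gradip O (u - uh) (v - uh)) (lu := lam u) (luh := lam uh) (lvh := lam v)
  (iu := inner0 O u lamh) (iuh := inner0 O uh lamh) (ivh := inner0 O v lamh)
  (gi := inner0 O g lamh) (juh := inner0 O uh m)).
- rewrite (gradipC O _ (u - v)) (gradipC O _ (v - uh)).
  rewrite -(gradipD oO (H10_H1 Huv) (H10_H1 Hw) (H10_H1 He)).
  by rewrite addrA subrK.
- apply: le_trans (ler_norm _) _.
  by apply: gradip_CS => //; exact: H10_H1.
- rewrite error_orthogonality// (Hm1_sub Hlam Hv Huh).
  by rewrite (inner0B oO Lv Luh Llamh).
- have := pairing_le_norm oO (Hdiff Llamh) Huv.
  rewrite -[(lam - _) _]/(lam (u - v) - inner0 O (u - v) lamh).
  rewrite (Hm1_sub Hlam Hu Hv) (inner0B oO Lu Lv Llamh).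
  by rewrite ler_norml => /andP[+ _]; rewrite lerNl.
- exact: (obstacle_above oO us).
- exact: (fem_contact oO Lg Vh0 Qh0 Qh_lin VhH QhL hs).
- have := pairing_le oO (Hdiff Lm) He.
  rewrite -[(lam - _) _]/(lam (u - uh) - inner0 O (u - uh) m).
  by rewrite (Hm1_sub Hlam Hu Huh) (inner0B oO Lu Luh Lm).
- exact: (fem_above oO Lg Vh0 Qh0 Qh_lin VhH QhL hs).
Qed.

Lemma quasi_optimality v m : Vh v -> Lamh O Qh m ->
  norm1 O (u - uh) + normm1 O (lam - L2dual O lamh) <=
  (1 + beta^-1) * (2 * ((4 * M ^+ 2 + 1) * (2 + beta^-1)) + 1) *
  (norm1 O (u - v) + normm1 O (lam - L2dual O m) +
    Num.sqrt (pairing (u - g) (L2dual O m))).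
Proof.
move=> Vv Lm; have [Qm pm] := Lm.
apply: error_absorption.
- by rewrite lerDr mulr_ge0// sqr_ge0.
- by rewrite invr_ge0 ltW.
- exact: norm1_ge0.
- exact: norm1_ge0.
- exact/normm1_ge0/Hdiff.
- exact/normm1_ge0/Hdiff/QhL.
- exact: sqrtr_ge0.
- exact: multiplier_error.
(* The Poincaré inequality bounds the square of the full norm by 4 M^2 + 1 times the Dirichlet
   form. *)
have P := poincare oO OM He; have HE := energy_error Vv Lm.
rewrite norm1_sqr; move: P HE; set ee := gradip O (u - uh) (u - uh).
set ii := inner0 O (u - uh) (u - uh); set K := 4 * M ^+ 2.
set r := _ + _ + _ + _ => P HE.
have K0 : 0 <= K by rewrite mulr_ge0// sqr_ge0.
apply: (@le_trans _ _ ((K + 1) * ee)).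
  by rewrite mulrDl mul1r addrC lerD2r.
by rewrite ler_wpM2l// addr_ge0.
Qed.

End ErrorEstimate.

Theorem theorem3p7 (R : realType) (Omega : set (R * R)) (beta : R)
    (hOmega : convex_polygon Omega) (hbeta : 0 < beta) :
  exists2 C : R, 0 < C &
  forall (f g : R * R -> R),
    L2 Omega f ->
    H1 Omega g -> {within closure Omega, continuous g} ->
    (forall x, bdry Omega x -> g x = 0) ->
  forall (u : R * R -> R) (lam : (R * R -> R) -> R),
    obstacle_sol Omega f g u lam ->
  forall (kappa : R) (Th : seq (seq (R * R))) (Vh Qh : set (R * R -> R)),
    conforming_triangulation Omega Th -> shape_regular kappa Th ->
    fe_space Th Vh -> Vh `<=` H10 Omega ->
    fe_space Th Qh -> Qh `<=` L2 Omega ->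
    babuska_brezzi Omega beta Vh Qh ->
  forall (uh lamh : R * R -> R),
    mixed_fem_sol Omega f g Vh Qh uh lamh ->
  norm1 Omega (u - uh) + normm1 Omega (lam - L2dual Omega lamh) <=
  C * (inf [set norm1 Omega (u - vh) | vh in Vh] +
       inf [set normm1 Omega (lam - L2dual Omega mh) +
                Num.sqrt (pairing (u - g) (L2dual Omega mh))
           | mh in Lamh Omega Qh]).

Proof.
have [s Os] := proj2 hOmega.
have oO : open Omega by rewrite Os; exact: open_interior.
have [M HM] := chull_fst_bound s.
have OM x : Omega x -> `|x.1| <= M by rewrite Os => /interior_subset/HM.
(* Built from M and beta alone, before the data and the mesh are introduced. *)
pose C := (1 + beta^-1) * (2 * ((4 * M ^+ 2 + 1) * (2 + beta^-1)) + 1).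
have b0 : 0 < beta^-1 by rewrite invr_gt0.
have C0 : 0 < C.
  have h : 0 <= (4 * M ^+ 2 + 1) * (2 + beta^-1).
    by have := sqr_ge0 M; move=> ?; apply: mulr_ge0; lra.
  by apply: mulr_gt0; lra.
exists C => // f g Lf [Lg _ _] _ _ u lam us kappa Th Vh Qh _ _ [Vh0 Vh_lin _] VhH
  [Qh0 Qh_lin _] QhL BB uh lamh hs.
have [Vuh Llamh _] := hs.
have main := quasi_optimality oO OM hbeta Lf Lg us Vh0 Vh_lin Qh0 Qh_lin VhH QhL BB hs.
rewrite -/C in main.
(* The two infima are released one at a time; [lamh] and [uh] witness that the sets are nonempty,
   which being a lower bound does not ensure. *)
rewrite mulrC -ler_pdivrMr// -lerBlDl.
apply: lb_le_inf; first by eexists; exists lamh.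
move=> _ [m Lm <-]; rewrite lerBlDl -lerBlDr.
apply: lb_le_inf; first by eexists; exists uh.
move=> _ [v Vv <-]; rewrite lerBlDr ler_pdivrMr// mulrC addrA.
exact: main.
Qed.
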